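(* Let $N\ge 3$ be an integer, and let $\mathcal T_N$, $U_j$, $A_{2k+1}$, $A_{2k+2}$ be as defined in the context. (a) Let $N$ be odd and let $y_N^{(1)}$ be the maximum root of the equation $U_{(N+3)/2}(x)=0$. Then $$\max_{P\in\mathcal T_N}\{a_3\}=4(y_N^{(1)})^2-1,\qquad y_N^{(1)}=\cos\frac{2\pi}{N+5}.$$ The extremal polynomial $P(z)=z+\sum_{j=2}^N a_jz^j$ is unique; its coefficients are defined by $$a_{2k+1}=A_{2k+1}(y_N^{(1)}),\qquad a_{2k+2}=0,\quad k=0,\ldots,(N-1)/2.$$ (b) Let $N$ be even and let $y_N^{(3)}$ be the maximum root of the equation $U_{(N+2)/2}(x)=0$. Then $$\max_{P\in\mathcal T_N}\{a_3\}=4(y_N^{(3)})^2-1,\qquad y_N^{(3)}=\cos\frac{2\pi}{N+4}.$$ The collection of the extremal polynomials $P(z)=z+\sum_{j=2}^N a_jz^j$ forms a one-parameter family; the coefficients of these polynomials are defined by $$a_{2k+1}=A_{2k+1}(y_N^{(3)}),\quad a_{2k+2}=\tau A_{2k+2}(y_N^{(3)}),\quad \tau\in[-1,1],\quad k=0,\ldots,(N-2)/2.$$ (c) Let $N$ be odd, $(N+3)/2$ be odd, and let $y_N^{(5)}$ be the minimum positive root of the equation $U'_{(N+3)/2}(x)=0$. Then $$\min_{P\in\mathcal T_N}\{a_3\}=4(y_N^{(5)})^2-1 .$$ The extremal polynomial $P(z)=z+\sum_{j=2}^N a_jz^j$ is unique. With $$\zeta_k(x)=U_{k-1}(x)U_k(x)-U_{\frac{N+1}{2}-k}(x)U_{\frac{N+3}{2}-k}(x)+\Big(1-\frac{4k}{N+3}\Big)U_{\frac{N+1}{2}}(x)U_{\frac{N+3}{2}}(x),\quad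 k=1,\ldots,\tfrac{N+1}{2},$$ and $z_k=\zeta_k(y_N^{(5)})$, its coefficients are $$a_{2k-1}=\frac{\sum_{j=1}^{\frac{N+3}{2}-k}z_jz_{j+k-1}-\sum_{j=1}^{\frac{N+1}{2}-k}z_jz_{j+k}}{\sum_{j=1}^{\frac{N+1}{2}}z_jz_j-\sum_{j=1}^{\frac{N-1}{2}}z_jz_{j+1}},\qquad a_{2k}=0,\quad k=1,\ldots,\tfrac{N+1}{2}.$$ (d) Let $N$ be odd, $(N+3)/2$ be even, and let $y_N^{(2)}$ be the minimum positive root of the equation $U_{(N+3)/2}(x)=0$. Then $$\min_{P\in\mathcal T_N}\{a_3\}=4(y_N^{(2)})^2-1,\qquad y_N^{(2)}=\sin\frac{\pi}{N+5}.$$ The extremal polynomial $P(z)=z+\sum_{j=2}^N a_jz^j$ is unique; its coefficients are defined by $$a_{2k+1}=A_{2k+1}(y_N^{(2)}),\qquad a_{2k+2}=0,\quad k=0,\ldots,(N-1)/2.$$ (e) Let $N$ be even, $(N+2)/2$ be odd, and let $y_N^{(6)}$ be the minimum positive root of the equation $U'_{(N+2)/2}(x)=0$. Then $$\min_{P\in\mathcal T_N}\{a_3\}=4(y_N^{(6)})^2-1 .$$ The set of the extremal polynomials $P(z)=z+\sum_{j=2}^N a_jz^j$ forms a one-parameter family. With $$\zeta^*_k(x)=U_{k-1}(x)U_k(x)-U_{\frac{N}{2}-k}(x)U_{\frac{N+2}{2}-k}(x)+\Big(1-\frac{4k}{N+2}\Big)U_{\frac{N}{2}}(x)U_{\frac{N+2}{2}}(x),\quad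 k=1,\ldots,\tfrac N2,$$ and $z_k=\zeta_k^*(y_N^{(6)})$, one has, for $\tau\in[-1,1]$ and $k=1,\ldots,N/2$, $$a_{2k-1}=\frac{\sum_{j=1}^{\frac{N+2}{2}-k}z_jz_{j+k-1}-\sum_{j=1}^{\frac{N}{2}-k}z_jz_{j+k}}{\sum_{j=1}^{\frac{N}{2}}z_jz_j-\sum_{j=1}^{\frac{N-2}{2}}z_jz_{j+1}},\qquad a_{2k}=\tau\,\frac{\sum_{j=1}^{\frac{N+2}{2}-k}z_jz_{j+k-1}-\sum_{j=1}^{\frac{N-2}{2}-k}z_jz_{j+k+1}}{\sum_{j=1}^{\frac{N}{2}}z_jz_j-\sum_{j=1}^{\frac{N-2}{2}}z_jz_{j+1}}.$$ (f) Let $N$ be even, $(N+2)/2$ be even, and let $y_N^{(4)}$ be the minimum positive root of the equation $U_{(N+2)/2}(x)=0$. Then $$\min_{P\in\mathcal T_N}\{a_3\}=4(y_N^{(4)})^2-1,\qquad y_N^{(4)}=\sin\frac{\pi}{N+4}.$$ The collection of the extremal polynomials $P(z)=z+\sum_{j=2}^N a_jz^j$ forms a one-parameter family; the coefficients of these polynomials are defined by $$a_{2k+1}=A_{2k+1}(y_N^{(4)}),\quad a_{2k+2}=\tau A_{2k+2}(y_N^{(4)}),\quad \tau\in[-1,1],\quad k=0,\ldots,(N-2)/2.$$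
   Context: Let $\mathbb D=\{z\in\mathbb C:|z|<1\}$. A holomorphic function $F$ on $\mathbb D$ is typically real if $F(z)\in\mathbb R$ for all $z\in\mathbb D\cap\mathbb R$ and $\operatorname{Im}F(z)\cdot\operatorname{Im}z>0$ for all $z\in\mathbb D\setminus\mathbb R$. $\mathcal T_N$ is the set of normalized typically real polynomials of degree $N$, $P(z)=z+\sum_{j=2}^N a_jz^j$ with $a_N\neq0$, on $\mathbb D$; their coefficients are automatically real. $a_3$ denotes the coefficient of $z^3$ in $P$. An extremal polynomial is one attaining the maximum (resp. minimum) of $a_3$. A coefficient with index larger than $N$ is read as $0$. $U_j$ is the Chebyshev polynomial of the second kind, $U_j(\cos t)=\sin((j+1)t)/\sin t$, with $U_{-1}\equiv0$, and $U_j'$ is its derivative. Empty sums are $0$. For $k\in\mathbb N_0$ set $$A_{2k+1}(y)=U_{2k}(y)+\alpha_N\cdot\frac{y}{1-y^2}\left(y+U_{2k-1}(y)\frac{3y^2-1}{2y^2}-U_{2k}(y)\frac{k(1-y^2)+y^2}{y}\right),$$ where $\alpha_N=2/(N+5)$ if $N$ is odd and $\alpha_N=2/(N+4)$ if $N$ is even. For even $N$ and $k=0,\ldots,(N-2)/2$ set $$A_{2k+2}(y)=\frac{4}{N+4}\,y(1-y^2)\,U_k(y)\,U'_{N/2-k}(y).$$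
   Formalization: In (e) the formula for a_{2k} has τ/2 in place of τ, since the printed one fails for N=4, τ=1; in (b), (e), (f) τ=0 is excluded over T_N because it gives a_N=0, and the full range τ∈[-1,1] is stated for polynomials of degree at most N. *)

(* Defs.v *)
(* MathComp / MathComp-Analysis; complex numbers are R[i] over R : realType. *)
From HB Require Import structures.
From mathcomp Require Export all_boot all_order all_algebra.
From mathcomp Require Export all_classical all_reals all_analysis.
From mathcomp Require Export complex.
From mathcomp Require Import ring.
Set Implicit Arguments.
Unset Strict Implicit.
Unset Printing Implicit Defensive.
Import Order.TTheory GRing.Theory Num.Theory.
Import numFieldNormedType.Exports.
Local Open Scope classical_set_scope.
Local Open Scope ring_scope.
Local Open Scope complex_scope.

Section TypicallyReal.
Variable R : realType.
Local Notation C := R[i].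

Definition unit_disk : set C := [set z | `|z| < 1].

(* The topology and module structure on C are those of C^o, so that
   derivability in the direction 1 is complex differentiability. *)
Definition holomorphic_on (D : set C) (F : C -> C) : Prop :=
  forall z, D z -> derivable (F : C^o -> C^o) z 1.

Definition typically_real (F : C -> C) : Prop :=
  [/\ holomorphic_on unit_disk F,
      forall z, unit_disk z -> complex.Im z = 0 -> complex.Im (F z) = 0
    & forall z, unit_disk z -> complex.Im z != 0 -> 0 < complex.Im (F z) * complex.Im z].

(* P = z + \sum_(2 <= j <= N) a_j z^j, with a_N = 0 allowed. *)
Definition normalized_poly (N : nat) (P : {poly C}) : Prop :=
  [/\ (size P <= N.+1)%N, P`_0 = 0 & P`_1 = 1].

Definition T (N : nat) : set {poly C} :=
  [set P | [/\ normalized_poly N P, P`_N != 0 & typically_real (horner P)]].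

(* Degree at most N instead of exactly N. *)
Definition T_le (N : nat) : set {poly C} :=
  [set P | normalized_poly N P /\ typically_real (horner P)].

(* On R[i], u <= v means that v - u is a nonnegative real; the coefficients of
   typically real polynomials are real, so this is the usual order on them. *)
Definition is_maximum (S : set C) (m : C) : Prop := S m /\ ubound S m.

Definition is_minimum (S : set C) (m : C) : Prop := S m /\ lbound S m.

Definition a3_values (N : nat) : set C := [set P`_3 | P in T N].

Definition max_extremal (S : set {poly C}) (P : {poly C}) : Prop :=
  S P /\ forall Q, S Q -> Q`_3 <= P`_3.

Definition min_extremal (S : set {poly C}) (P : {poly C}) : Prop :=
  S P /\ forall Q, S Q -> P`_3 <= Q`_3.

End TypicallyReal.

Arguments T : clear implicits.
Arguments T_le : clear implicits.
Arguments a3_values : clear implicits.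

Section Chebyshev.
Variable R : realType.

(* Index shifted by one, so that chebV n = U_(n-1). *)
Fixpoint chebV (n : nat) : {poly R} :=
  if n is n'.+1 then
    if n' is m.+1 then 'X *+ 2 * chebV n' - chebV m else 1
  else 0.

(* Indexed by int because U_(-1) = 0 occurs; chebU_cos characterizes U_j. *)
Definition chebU (j : int) : {poly R} :=
  match j with Posz n => chebV n.+1 | Negz n => - chebV n end.

Lemma chebV_cos (n : nat) (t : R) :
  (chebV n).[cos t] * sin t = sin (n%:R * t).
Proof.
have H : forall n, (chebV n).[cos t] * sin t = sin (n%:R * t) /\
    (chebV n.+1).[cos t] * sin t = sin (n.+1%:R * t).
  elim=> [|m [IH1 IH2]].
    by rewrite /= horner0 hornerC !mul0r sin0 !mul1r.
  split=> //; rewrite -[chebV m.+2]/('X *+ 2 * chebV m.+1 - chebV m).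
  rewrite hornerD hornerN hornerM hornerMn hornerX mulrBl IH1 -mulrA IH2.
  have -> : m.+2%:R * t = m.+1%:R * t + t
    by rewrite -natr1 mulrDl mul1r.
  have -> : m%:R * t = m.+1%:R * t - t
    by rewrite -[m.+1%:R]natr1 mulrDl mul1r addrK.
  rewrite sinB sinD.
  have -> : forall u v w : R, u *+ 2 * v - (v * u - w) = v * u + w
    by move=> u v w; ring.
  by [].
by case: (H n).
Qed.

Lemma chebU_cos (j : int) (t : R) : sin t != 0 ->
  (chebU j).[cos t] = sin ((j + 1)%:~R * t) / sin t.
Proof.
move=> st; apply: (mulIf st); rewrite mulfVK//.
case: j => n; first by rewrite chebV_cos -[(Posz n + 1)]/(Posz (n + 1)) addn1.
rewrite /chebU hornerN mulNr chebV_cos NegzE -addn1 PoszD opprD addrNK.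
by rewrite mulrNz mulNr sinN.
Qed.

Definition is_max_root (p : {poly R}) (y : R) : Prop :=
  root p y /\ forall x, root p x -> x <= y.

Definition is_min_pos_root (p : {poly R}) (y : R) : Prop :=
  [/\ 0 < y, root p y & forall x, 0 < x -> root p x -> y <= x].

End Chebyshev.

Arguments chebU {R}.

Section Coefficients.
Variable R : realType.
Local Notation U j x := ((chebU j).[x]).
Local Notation U' j x := ((deriv (chebU j)).[x]).

Definition alpha (N : nat) : R :=
  if odd N then 2 / (N + 5)%:R else 2 / (N + 4)%:R.

(* A_(2k+1)(y) *)
Definition A_odd (N k : nat) (y : R) : R :=
  U (2 * k)%N y + alpha N * (y / (1 - y ^+ 2)) *
    (y + U (2 * k%:Z - 1) y * ((3 * y ^+ 2 - 1) / (2 * y ^+ 2))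
       - U (2 * k)%N y * ((k%:R * (1 - y ^+ 2) + y ^+ 2) / y)).

(* A_(2k+2)(y), for N even and k <= (N - 2) / 2 *)
Definition A_even (N k : nat) (y : R) : R :=
  4 / (N + 4)%:R * y * (1 - y ^+ 2) * U k y * U' (N./2 - k)%N y.

Definition zeta (N k : nat) (x : R) : R :=
  U (k - 1)%N x * U k x
  - U ((N + 1)./2 - k)%N x * U ((N + 3)./2 - k)%N x
  + (1 - (4 * k)%:R / (N + 3)%:R) * U ((N + 1)./2) x * U ((N + 3)./2) x.

Definition zeta_star (N k : nat) (x : R) : R :=
  U (k - 1)%N x * U k x
  - U (N./2 - k)%N x * U ((N + 2)./2 - k)%N x
  + (1 - (4 * k)%:R / (N + 2)%:R) * U (N./2) x * U ((N + 2)./2) x.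

(* Empty if n = 0. *)
Definition corr (z : nat -> R) (n d : nat) : R :=
  \sum_(1 <= j < n.+1) z j * z (j + d)%N.

Local Notation C := R[i].

Definition coefs_A (N : nat) (y : R) (P : {poly C}) : Prop :=
  forall k, (k <= (N - 1)./2)%N ->
    P`_(2 * k + 1) = (A_odd N k y)%:C /\ P`_(2 * k + 2) = 0.

Definition family_A (N : nat) (y tau : R) (P : {poly C}) : Prop :=
  normalized_poly N P /\
  forall k, (k <= (N - 2)./2)%N ->
    P`_(2 * k + 1) = (A_odd N k y)%:C /\
    P`_(2 * k + 2) = (tau * A_even N k y)%:C.

Definition coefs_zeta (N : nat) (y : R) (P : {poly C}) : Prop :=
  let z k := zeta N k y in
  forall k, (1 <= k <= (N + 1)./2)%N ->
    P`_(2 * k - 1) =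
      ((corr z ((N + 3)./2 - k) (k - 1) - corr z ((N + 1)./2 - k) k) /
       (corr z (N + 1)./2 0 - corr z (N - 1)./2 1))%:C /\
    P`_(2 * k) = 0.

(* The factor 1 / 2 in the even coefficients is needed for tau to range over
   [-1, 1]: for N = 4 one has z_2 = - z_1, and with tau = 1 but no such factor
   the polynomial would be z + 2/3 z^2 - 1/3 z^3 - 1/3 z^4, for which
   Im P(e^(it)) / sin t = 4/3 (1 - x^2) (1 + 2 x) at x = cos t, which is
   negative on ]-1, -1/2[; the extremal ones there have |a_4| <= 1/6. *)
Definition family_zeta (N : nat) (y tau : R) (P : {poly C}) : Prop :=
  let z k := zeta_star N k y in
  normalized_poly N P /\
  forall k, (1 <= k <= N./2)%N ->
    P`_(2 * k - 1) =
      ((corr z ((N + 2)./2 - k) (k - 1) - corr z (N./2 - k) k) /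
       (corr z N./2 0 - corr z (N - 2)./2 1))%:C /\
    P`_(2 * k) =
      (tau / 2 *
       ((corr z ((N + 2)./2 - k) (k - 1) - corr z ((N - 2)./2 - k) (k + 1)) /
        (corr z N./2 0 - corr z (N - 2)./2 1)))%:C.

(* ext is max_extremal or min_extremal. The member tau = 0 of fam has a_N = 0,
   so it lies in T_le N but not in T N; over T N the parameter set is
   [-1, 1] without 0. *)
Definition extremal_family (ext : set {poly C} -> {poly C} -> Prop) (N : nat)
    (fam : R -> {poly C} -> Prop) : Prop :=
  (forall P, ext (T R N) P <->
     exists tau : R, [/\ -1 <= tau <= 1, tau != 0 & fam tau P]) /\
  (forall P, ext (T_le R N) P <->
     exists tau : R, -1 <= tau <= 1 /\ fam tau P).

End Coefficients.

(* Main.v *)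
(* Write a normalized real polynomial P = z + a_2 z^2 + ... as
   Q(x) = a_1 U_0(x) + a_2 U_1(x) + ...  Since Im P(e^(it)) = sin t Q(cos t), P is
   typically real exactly when Q >= 0 on [-1, 1]; inside the disk, the
   Gauss quadrature at the zeros of U_n writes P as a positive combination of
   truncations of z / (1 - 2 x z + z^2), whose imaginary parts have the sign of
   Im z for n large.

   Let I be integration against (2 / pi) sqrt(1 - x^2), so that a_1 = I(Q) and
   a_3 = I((4 x^2 - 1) Q).  A quadrature rule with positive weights, exact up to
   degree N + 1, whose nodes x all satisfy x^2 <= y^2 (resp. x^2 >= y^2) shows that
   a_3 is at most (resp. at least) 4 y^2 - 1, with equality only if Q vanishes at all
   nodes but y and - y.  The rule is the Gauss rule at the zeros of U_m or the
   Lobatto rule at 1, -1 and the zeros of U_m', with m = (N + 3) / 2 or (N + 2) / 2, and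
   counting double zeros Q is a multiple of U_m^2 / (x^2 - y^2)^2 or of
   (1 - x^2) U_m'^2 / (x^2 - y^2)^2, up to a factor 1 + tau x when N is even.

   The coefficients of these polynomials are found by undoing the multiplication
   by x^2 - y^2, which acts as a second-order difference operator on coefficients in
   the basis U_(2k).  For the A_(2k+1), applying it twice gives a constant sequence,
   and U_m^2 is the sum of the U_(2k).  For the zeta_k, the coefficients
   a_(2k-1) are differences of autocorrelations, so Q(cos t) is proportional to
   |sum_j z_j e^(2ijt)|^2, and applying the operator once to z gives the
   coefficients of U_m'. *)
Require Import Defs.
From HB Require Import structures.
From mathcomp Require Import ring lra zify.
From mathcomp Require polyorder polyrcf.
Import Order.TTheory GRing.Theory Num.Theory.
Import numFieldNormedType.Exports.
Set Implicit Arguments.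
Unset Strict Implicit.
Unset Printing Implicit Defensive.
Local Open Scope classical_set_scope.
Local Open Scope ring_scope.
Local Open Scope complex_scope.

(** * Chebyshev polynomials *)

Section ChebyshevIdentities.
Variable R : realType.
Local Notation V := (chebV R).

Lemma chebVSS n : V n.+2 = 'X *+ 2 * V n.+1 - V n.
Proof. by []. Qed.

Lemma hchebVSS n x : (V n.+2).[x] = 2 * x * (V n.+1).[x] - (V n).[x].
Proof. by rewrite chebVSS !hornerE mulr2n; ring. Qed.

Lemma size_chebV n : size (V n) = n.
Proof.
suff : size (V n) = n /\ size (V n.+1) = n.+1 by case.
elim: n => [|n [IH1 IH2]]; first by rewrite /= size_poly0 size_poly1.
have E : 'X *+ 2 * V n.+1 = 2%:R *: (V n.+1 * 'X).
  by rewrite mulrC -scaler_nat scalerAr.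
have S : size (2%:R *: (V n.+1 * 'X)) = n.+2.
  by rewrite size_scale ?pnatr_eq0// size_mulX ?IH2// -size_poly_gt0 IH2.
by split=> //; rewrite chebVSS E size_polyDl S// size_polyN IH1.
Qed.

Lemma chebVN n x : (V n).[- x] = (-1) ^+ n.+1 * (V n).[x].
Proof.
suff : (V n).[- x] = (-1) ^+ n.+1 * (V n).[x] /\
  (V n.+1).[- x] = (-1) ^+ n.+2 * (V n.+1).[x] by case.
elim: n => [|n [IH1 IH2]]; first by rewrite /= !hornerE; split; ring.
split=> //; rewrite !hchebVSS IH1 IH2 !exprS; ring.
Qed.

(** The quadratic form [u^2 - 2 x u v + v^2] is invariant under the recurrence. At a zero of one
    [V k] it makes the neighbouring values [+-1]. *)
Lemma chebV_pell n x :
  (V n.+1).[x] ^+ 2 - 2 * x * (V n.+1).[x] * (V n).[x] + (V n).[x] ^+ 2 = 1.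
Proof.
elim: n => [|n IH]; first by rewrite /= !hornerE; ring.
by rewrite -[RHS]IH hchebVSS; ring.
Qed.

Lemma deriv_chebVSS n : (V n.+2)^`() = V n.+1 *+ 2 + 'X *+ 2 * (V n.+1)^`() - (V n)^`().
Proof. by rewrite chebVSS derivB derivM derivMn derivX; ring. Qed.

(** Obtained on paper by differentiating [V n (cos t) * sin t = sin (n t)] and writing [cos (n t)]
    as [V n.+1 - x * V n]. *)
Lemma chebV_deriv n :
  (1 - 'X^2) * (V n)^`() = n.+1%:R * 'X * V n - n%:R * V n.+1.
Proof.
suff : (1 - 'X^2) * (V n)^`() = n.+1%:R * 'X * V n - n%:R * V n.+1 /\
 (1 - 'X^2) * (V n.+1)^`() = n.+2%:R * 'X * V n.+1 - n.+1%:R * V n.+2 by case.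
elim: n => [|n [IH1 IH2]].
  by rewrite /= derivC -[1]/(1%:P) derivC; split; ring.
split=> //; rewrite deriv_chebVSS.
transitivity ((1 - 'X^2) * V n.+1 *+ 2 + 'X *+ 2 * ((1 - 'X^2) * (V n.+1)^`()) - (1 - 'X^2) * (V n)^`()).
  by ring.
rewrite IH1 IH2 !chebVSS -!natr1; ring.
Qed.

Lemma deriv_chebV_diff n : (V n.+2)^`() = (V n)^`() + (n.+1%:R *+ 2) * V n.+1.
Proof.
have nz : (1 - 'X^2 : {poly R}) != 0.
  by rewrite -size_poly_eq0 -opprB size_polyN size_XnsubC.
apply: (mulfI nz); rewrite mulrDr !chebV_deriv !chebVSS -!natr1; ring.
Qed.

(** These are [sin (2 n t) = 2 sin (n t) cos (n t)] and [sin ((2 n + 1) t) sin t = sin ((n + 1) t)^2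
    - sin (n t)^2], with [cos (n t) = V n.+1 - x * V n]. *)
Lemma chebV_double n :
  V n.*2 = V n * (V n.+1 *+ 2 - 'X *+ 2 * V n) /\ V n.*2.+1 = V n.+1 ^+ 2 - V n ^+ 2.
Proof.
elim: n => [|n [IH1 IH2]]; first by rewrite /=; split; ring.
have E : V n.+1.*2 = V n.+1 * (V n.+2 *+ 2 - 'X *+ 2 * V n.+1).
  by rewrite doubleS chebVSS IH1 IH2 chebVSS; ring.
by split=> //; rewrite {1}doubleS chebVSS -doubleS E IH2 !chebVSS; ring.
Qed.

Lemma sum_chebV_odd n : \sum_(j < n) V j.*2.+1 = V n ^+ 2.
Proof.
elim: n => [|n IH]; first by rewrite big_ord0 /= expr0n.
by rewrite big_ord_recr IH /=  -/(chebV _ n.*2.+1) (chebV_double n).2 addrC subrK.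
Qed.

Lemma cos_inj_poly (p q : {poly R}) :
  (forall t, sin t != 0 -> p.[cos t] = q.[cos t]) -> p = q.
Proof.
move=> H; apply/eqP; rewrite -subr_eq0; apply/negPn/negP => nz.
(* These are the points [1 / (i + 2)], distinct and inside ]-1, 1[, one more than the degree of
   [p - q] allows as zeros. *)
pose s := [seq cos (acos i.+2%:R^-1) : R | i <- iota 0 (size (p - q))].
have xP i : -1 < (i.+2%:R^-1 : R) < 1.
  rewrite invf_lt1 ?ltr0n// ltr1n andbT; apply: (@lt_trans _ _ 0) => //.
have xP' i : (i.+2%:R^-1 : R) \in `[-1, 1].
  by case/andP: (xP i) => a b; rewrite in_itv /= !ltW.
have /max_poly_roots : all (root (p - q)) s.
  apply/allP => _ /mapP[i _ ->]; rewrite /root !hornerE H ?subrr//.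
  rewrite sin_acos; last by case/andP: (xP i) => a b; rewrite !ltW.
  rewrite gt_eqF// sqrtr_gt0 subr_gt0.
  rewrite expr_lt1// ?invr_ge0// ; by case/andP: (xP i).
move=> /(_ nz); rewrite size_map size_iota ltnn => F.
suff // : false by []; apply: F.
rewrite map_inj_uniq ?iota_uniq// => i j.
rewrite !acosK ?xP'// => /invr_inj/eqP; rewrite eqr_nat => /eqP[]//.
Qed.

End ChebyshevIdentities.

Arguments chebV : simpl never.

(** * Chebyshev coefficients and Gauss quadrature *)

Section ChebyshevCoefficients.
Variable R : realType.
Local Notation V := (chebV R).

(* Coefficient of [U_k] in ['X^i]. *)
Fixpoint Xn_ucoef (i k : nat) : R :=
  if i is i'.+1 then
    (Xn_ucoef i' k.+1 + (if k is k'.+1 then Xn_ucoef i' k' else 0)) / 2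
  else (k == 0)%:R.

(* Coefficient of [U_k] in [p]; [ucoef 0] is integration against the weight
   [2 / pi * sqrt (1 - x ^ 2)] on [-1, 1]. *)
Definition ucoef (k : nat) (p : {poly R}) : R :=
  \sum_(i < size p) p`_i * Xn_ucoef i k.

Lemma ucoef_widen k n (p : {poly R}) : (size p <= n)%N ->
  ucoef k p = \sum_(i < n) p`_i * Xn_ucoef i k.
Proof.
move=> h; rewrite /ucoef (big_ord_widen n (fun i => p`_i * Xn_ucoef i k))//.
rewrite big_mkcond; apply: eq_bigr => i _; case: ltnP => // le.
by rewrite nth_default// mul0r.
Qed.

Lemma ucoef_linear k : linear (ucoef k : {poly R} -> R^o).
Proof.
move=> a p q; pose n := maxn (size p) (size q).
have hp : (size p <= n)%N by rewrite leq_maxl.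
have hq : (size q <= n)%N by rewrite leq_maxr.
have hpq : (size (a *: p + q)%R <= n)%N.
  by rewrite (leq_trans (size_polyD _ _))// geq_max hq andbT (leq_trans (size_scale_leq _ _)).
rewrite (ucoef_widen k hp) (ucoef_widen k hq) (ucoef_widen k hpq).
rewrite scaler_sumr -big_split /=; apply: eq_bigr => i _.
by rewrite coefD coefZ mulrDl -mulrA.
Qed.

HB.instance Definition _ k :=
  GRing.isLinear.Build R {poly R} R^o _ (ucoef k) (ucoef_linear k).

Lemma ucoefZ k a p : ucoef k (a *: p) = a * ucoef k p.
Proof. exact: (linearZ_LR (ucoef k)). Qed.

Lemma ucoefMX k p :
  ucoef k (p * 'X) = (ucoef k.+1 p + (if k is k'.+1 then ucoef k' p else 0)) / 2.
Proof.
have h : (size (p * 'X)%R <= (size p).+1)%N.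
  by have [->|nz] := eqVneq p 0; rewrite ?mul0r ?size_poly0// size_mulX.
rewrite (ucoef_widen k h) big_ord_recl coefMX /= mul0r add0r.
under eq_bigr => i _ do rewrite coefMX /= mulrA mulrDr.
rewrite -mulr_suml big_split /=; congr (( _ + _) / 2).
by case: k {h} => [|k] //; rewrite big1// => i _; rewrite mulr0.
Qed.

Lemma ucoef_chebV k n : ucoef k (V n.+1) = (k == n)%:R.
Proof.
suff : forall k, ucoef k (V n.+1) = (k == n)%:R /\ ucoef k (V n.+2) = (k == n.+1)%:R.
  by case/(_ k).
elim: n {k} => [|n IH] k.
  have E j : ucoef j (V 1) = (j == 0)%:R.
    by rewrite /ucoef size_poly1 big_ord1 coef1 /= mul1r.
  split=> //; rewrite chebVSS subr0 mulrC mulrnAr raddfMn /= ucoefMX.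
  by rewrite mulr2n -splitr; case: k => [|k]; rewrite !E ?addr0// add0r.
split; first by case: (IH k).
rewrite chebVSS raddfB /= mulrC mulrnAr raddfMn /= ucoefMX.
rewrite mulr2n -splitr (IH k).1 (IH k.+1).2.
case: k => [|k]; first by rewrite /= addr0 eqSS eq_sym subrr.
by rewrite (IH k).2 !eqSS addrAC subrr add0r.
Qed.

(* As [2 x U_k = U_(k+1) + U_(k-1)], multiplication by [x] is symmetric in the
   basis of the [U_k]. *)
Lemma ucoef0_chebV p k : ucoef 0 (p * V k.+1) = ucoef k p.
Proof.
suff : forall p, ucoef 0 (p * V k.+1) = ucoef k p /\
   ucoef 0 (p * V k.+2) = ucoef k.+1 p by case/(_ p).
elim: k {p} => [|k IH] p.
  split; first by rewrite mulr1.
  by rewrite chebVSS /= subr0 mulr1 mulrnAr raddfMn /= ucoefMX addr0 mulr2n -splitr.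
split; first by case: (IH p).
have -> : p * V k.+3 = (p * 'X * V k.+2) *+ 2 - p * V k.+1 by rewrite chebVSS; ring.
rewrite raddfB raddfMn /= (IH (p * 'X)).2 ucoefMX (IH p).1.
by rewrite mulr2n -splitr addrK.
Qed.

Lemma chebV_expansion n (p : {poly R}) : (size p <= n)%N ->
  p = \sum_(k < n) ucoef k p *: V k.+1.
Proof.
move=> h.
(* Any coefficients will do, since [ucoef_chebV] identifies them afterwards; they come from
   stripping leading terms. *)
have [b pE] : exists b : nat -> R, p = \sum_(k < n) b k *: V k.+1.
  elim: n p h => [|n IH] p h.
    by exists (fun=> 0); rewrite big_ord0; apply/eqP; rewrite -size_poly_leq0.
  pose c := p`_n / lead_coef (V n.+1).
  have nz : lead_coef (V n.+1) != 0.
    by rewrite lead_coef_eq0 -size_poly_eq0 size_chebV.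
  have /IH[b bE] : (size (p - c *: V n.+1)%R <= n)%N.
    apply/leq_sizeP => j; rewrite leq_eqVlt => /predU1P[<-|lt].
      rewrite coefB coefZ /c; move: nz; rewrite lead_coefE size_chebV /= => nz.
      by rewrite divfK// subrr.
    rewrite coefB coefZ !nth_default ?mulr0 ?subrr ?size_chebV//.
    exact: leq_trans lt.
  exists (fun k => if k == n then c else b k).
  rewrite big_ord_recr /= eqxx -[LHS](subrK (c *: V n.+1)) bE; congr (_ + _).
  by apply: eq_bigr => k _; rewrite (ltn_eqF (ltn_ord k)).
rewrite {1}pE; apply: eq_bigr => k _; congr (_ *: _).
rewrite pE raddf_sum /= (bigD1 k)//= ucoefZ ucoef_chebV eqxx mulr1.
rewrite big1 ?addr0// => j jk; rewrite ucoefZ ucoef_chebV.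
by rewrite eq_sym (inj_eq val_inj) (negbTE jk) mulr0.
Qed.

Lemma ucoef_big k (p : {poly R}) : (size p <= k)%N -> ucoef k p = 0.
Proof.
move=> h; rewrite (chebV_expansion h) raddf_sum big1//= => j _.
by rewrite ucoefZ ucoef_chebV gtn_eqF ?mulr0.
Qed.

(** Parseval: the [U_k] are orthonormal for [ucoef 0], so the value is the sum of the squared
    coefficients. *)
Lemma ucoef0_sqr_gt0 p : p != 0 -> 0 < ucoef 0 (p ^+ 2).
Proof.
move=> nz; have -> : ucoef 0 (p ^+ 2) = \sum_(k < size p) ucoef k p ^+ 2.
  rewrite expr2 {2}(chebV_expansion (leqnn (size p))) mulr_sumr raddf_sum /=.
  by apply: eq_bigr => k _; rewrite -scalerAr ucoefZ ucoef0_chebV.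
rewrite lt0r sumr_ge0 ?andbT => [|k _]; last exact: sqr_ge0.
apply: contraNneq nz => /psumr_eq0P H.
rewrite (chebV_expansion (leqnn (size p))) big1// => k _.
have /eqP := H (fun k _ => sqr_ge0 _) k isT.
by rewrite sqrf_eq0 => /eqP->; rewrite scale0r.
Qed.

(** * Interpolatory quadrature *)

Definition lagrange_at (s : seq R) (x : R) : {poly R} :=
  \prod_(y <- s | y != x) ('X - y%:P).

Lemma lagrange_at_self s x : (lagrange_at s x).[x] != 0.
Proof.
rewrite /lagrange_at horner_prod prodf_seq_neq0; apply/allP => y _ /=.
by apply/implyP => yx; rewrite hornerXsubC subr_eq0 eq_sym.
Qed.

Lemma lagrange_at_other s x y : y \in s -> y != x -> (lagrange_at s x).[y] = 0.
Proof.
move=> ys yx; apply/eqP; rewrite horner_prod prodf_seq_eq0.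
by apply/hasP; exists y => //; rewrite yx hornerXsubC subrr eqxx.
Qed.

Lemma prod_lagrange_at s x : uniq s -> x \in s ->
  \prod_(y <- s) ('X - y%:P) = ('X - x%:P) * lagrange_at s x.
Proof. by move=> us xs; rewrite (bigD1_seq x). Qed.

Lemma size_lagrange_at s x : uniq s -> x \in s -> size (lagrange_at s x) = size s.
Proof.
move=> us xs; have := size_prod_XsubC s (fun y => y).
rewrite (prod_lagrange_at us xs) size_monicM ?monicXsubC ?size_XsubC//.
  by rewrite add2n => -[].
by apply: contraNneq (lagrange_at_self s x) => ->; rewrite horner0.
Qed.

Definition weight (s : seq R) (x : R) : R :=
  ucoef 0 (lagrange_at s x) / (lagrange_at s x).[x].

(** The difference of [p] and its Lagrange interpolant [L] is the node polynomial times some [q],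
    and the size bound on [p] puts [q] in the range of the orthogonality hypothesis. *)
Lemma quadrature (s : seq R) d : uniq s ->
  (forall q : {poly R}, (size q <= d)%N -> ucoef 0 (\prod_(y <- s) ('X - y%:P) * q) = 0) ->
  forall p : {poly R}, (size p <= size s + d)%N ->
  ucoef 0 p = \sum_(x <- s) weight s x * p.[x].
Proof.
move=> us orth p hp.
pose L := \sum_(x <- s) (p.[x] / (lagrange_at s x).[x]) *: lagrange_at s x.
have LE : ucoef 0 L = \sum_(x <- s) weight s x * p.[x].
  rewrite raddf_sum /=; apply: eq_bigr => x _.
  by rewrite ucoefZ /weight; ring.
have sL : (size L <= size s)%N.
  rewrite /L big_seq; apply: (big_ind (fun q : {poly R} => (size q <= size s)%N)).
  - by rewrite size_poly0.
  - by move=> a b ha hb; rewrite (leq_trans (size_polyD _ _))// geq_max ha.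
  - by move=> x xs; rewrite (leq_trans (size_scale_leq _ _))// size_lagrange_at.
have /dvdpP[q qE] : \prod_(y <- s) ('X - y%:P) %| p - L.
  apply: uniq_roots_dvdp; last by rewrite uniq_rootsE.
  apply/allP => x xs; rewrite /root hornerD hornerN /L horner_sum.
  rewrite (bigD1_seq x)//= hornerZ divfK ?lagrange_at_self//.
  rewrite big_seq_cond big1 ?addr0 ?subrr// => y /andP[ys yx].
  by rewrite hornerZ (lagrange_at_other xs) ?mulr0// eq_sym.
rewrite -LE; apply/eqP; rewrite -subr_eq0 -raddfB /= qE mulrC orth//.
have [->|nzq] := eqVneq q 0; first by rewrite size_poly0.
have : (size (p - L)%R <= size s + d)%N.
  rewrite (leq_trans (size_polyD _ _))// size_polyN geq_max hp (leq_trans sL)//.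
  by rewrite leq_addr.
rewrite qE size_Mmonic ?monic_prod_XsubC// size_prod_XsubC addnS /= addnC.
by rewrite leq_add2l.
Qed.

(** * The Gauss rule at the zeros of [V n.+1] *)

Lemma cos_nodeP n i : (i < n)%N ->
  0 < i.+1%:R * pi / n.+1%:R :> R /\ i.+1%:R * pi / n.+1%:R < pi :> R.
Proof.
move=> h; have p0 := pi_gt0 R.
split; first by rewrite divr_gt0 ?mulr_gt0 ?ltr0n.
rewrite ltr_pdivrMr ?ltr0n// mulrC.
by rewrite ltr_pM2l// ltr_nat ltnS.
Qed.

Lemma sin_natr_pi n : sin (n%:R * pi) = 0 :> R.
Proof.
elim: n => [|n IH]; first by rewrite mul0r sin0.
by rewrite -natr1 mulrDl mul1r sinDpi IH oppr0.
Qed.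

Definition gauss_nodes (n : nat) : seq R :=
  [seq cos (i.+1%:R * pi / n.+1%:R) | i <- iota 0 n].

Lemma gauss_nodes_itv n x : x \in gauss_nodes n -> -1 < x < 1.
Proof.
case/mapP => i; rewrite mem_iota add0n => /andP[_ /cos_nodeP[t0 t1]] ->.
set t : R := (X in cos X); have It : t \in `[0, pi] by rewrite in_itv /= !ltW.
have I0 : 0 \in `[0, pi : R] by rewrite in_itv /= lexx pi_ge0.
have Ipi : pi \in `[0, pi : R] by rewrite in_itv /= lexx pi_ge0.
by have := ltr_cos I0 It; have := ltr_cos It Ipi; rewrite cos0 cospi => -> ->; rewrite t0 t1.
Qed.

Lemma gauss_nodes_uniq n : uniq (gauss_nodes n).
Proof.
rewrite map_inj_in_uniq ?iota_uniq// => i j.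
rewrite !mem_iota !add0n /= => /cos_nodeP[i0 i1].
move=> /cos_nodeP[j0 j1] /cos_inj; rewrite !in_itv /= !ltW//.
move=> /(_ isT isT)/(divIf _)/(mulIf _) H; apply/succn_inj/eqP.
by rewrite -(eqr_nat R) H ?lt0r_neq0 ?pi_gt0// ?pnatr_eq0.
Qed.

Lemma gauss_nodes_root n x : x \in gauss_nodes n -> root (V n.+1) x.
Proof.
case/mapP => i; rewrite mem_iota add0n => /andP[_ hi ->].
have [t0 t1] := cos_nodeP hi.
have st : sin (i.+1%:R * pi / n.+1%:R : R) != 0 by rewrite gt_eqF// sin_gt0_pi// ?in_itv /= t0.
apply/eqP/(mulIf st); rewrite mul0r chebV_cos mulrC divfK ?pnatr_eq0//.
by rewrite sin_natr_pi.
Qed.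

Lemma size_gauss_nodes n : size (gauss_nodes n) = n.
Proof. by rewrite size_map size_iota. Qed.

Lemma chebV_factor n :
  V n.+1 = lead_coef (V n.+1) *: \prod_(y <- gauss_nodes n) ('X - y%:P).
Proof.
apply: all_roots_prod_XsubC; rewrite ?uniq_rootsE ?gauss_nodes_uniq//.
  by rewrite size_gauss_nodes size_chebV.
by apply/allP => x /gauss_nodes_root.
Qed.

Lemma mem_gauss_nodes n x : root (V n.+1) x = (x \in gauss_nodes n).
Proof.
apply/idP/idP; last exact: gauss_nodes_root.
rewrite chebV_factor rootZ ?root_prod_XsubC//.
by rewrite lead_coef_eq0 -size_poly_eq0 size_chebV.
Qed.

(** The node polynomial is a multiple of [V n.+1], and [ucoef 0 (q * V n.+1)] is the coefficient of
    [U_n] in [q], which is zero when [size q <= n]. *)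
Lemma gauss_quadrature n (p : {poly R}) : (size p <= n + n)%N ->
  ucoef 0 p = \sum_(x <- gauss_nodes n) weight (gauss_nodes n) x * p.[x].
Proof.
move=> hp; apply: (@quadrature _ n); rewrite ?gauss_nodes_uniq// ?size_gauss_nodes//.
move=> q hq; have := ucoef0_chebV q n; rewrite (ucoef_big hq) chebV_factor.
rewrite -scalerAr ucoefZ mulrC => /eqP; rewrite mulf_eq0 lead_coef_eq0.
by rewrite -size_poly_eq0 size_chebV orbF mulrC => /eqP.
Qed.

(** The rule is exact on the square of the Lagrange polynomial at [x], where only the term of [x]
    survives. *)
Lemma gauss_weight_gt0 n x : x \in gauss_nodes n -> 0 < weight (gauss_nodes n) x.
Proof.
move=> xs; set s := gauss_nodes n in xs *.
pose l := lagrange_at s x.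
have us : uniq s by rewrite gauss_nodes_uniq.
have sl : size l = n by rewrite size_lagrange_at// size_gauss_nodes.
have l0 : l.[x] != 0 by exact: lagrange_at_self.
have nz : l != 0 by apply: contraNneq l0 => ->; rewrite horner0.
have := ucoef0_sqr_gt0 nz; rewrite (@gauss_quadrature n).
  rewrite (bigD1_seq x)//= big_seq_cond big1 ?addr0 => [|y /andP[ys yx]].
    by rewrite horner_exp pmulr_lgt0// lt0r sqr_ge0 sqrf_eq0 l0.
  by rewrite horner_exp (lagrange_at_other ys yx) expr0n mulr0.
by rewrite expr2 (leq_trans (size_polyMleq _ _))// sl leq_pred.
Qed.

Definition nonneg_on_itv (p : {poly R}) := forall x, -1 <= x <= 1 -> 0 <= p.[x].

(** The Gauss rule with [size p] nodes is exact on [p], and a nonzero [p] cannot vanish at that many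
    points. *)
Lemma ucoef0_gt0 p : nonneg_on_itv p -> p != 0 -> 0 < ucoef 0 p.
Proof.
move=> p0 nz; set n := size p.
rewrite (@gauss_quadrature n) ?leq_addr// big_seq.
have F x : x \in gauss_nodes n -> 0 <= weight (gauss_nodes n) x * p.[x].
  move=> xs; apply: mulr_ge0; first by rewrite ltW// gauss_weight_gt0.
  apply: p0.
  by case/andP: (gauss_nodes_itv xs) => *; rewrite !ltW.
rewrite lt0r sumr_ge0// andbT -big_seq; apply/negP; rewrite big_seq psumr_eq0// => /allP H.
have /(max_poly_roots nz) : all (root p) (gauss_nodes n).
  apply/allP => x xs; move/(_ _ xs): H; rewrite xs /= mulf_eq0 => /orP[|//].
  by rewrite gt_eqF// gauss_weight_gt0.
by rewrite gauss_nodes_uniq size_gauss_nodes ltnn => /(_ isT).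
Qed.

End ChebyshevCoefficients.

(** * Lobatto quadrature *)

Section Positivity.
Variable R : realType.
Local Notation V := (chebV R).

Lemma poly_lt0_near (p : {poly R}) x : p.[x] < 0 ->
  exists2 e : R, 0 < e & forall z, `|z - x| < e -> p.[z] < 0.
Proof.
move=> px; have e0 : 0 < - p.[x] by rewrite oppr_gt0.
have /cvgrPdist_lt/(_ _ e0)[e /= e_gt0 H] := @continuous_horner R p x.
exists e => // z zx; have := H z; rewrite /= distrC => /(_ zx).
by rewrite distrC ltr_norml => /andP[_]; rewrite ltrBlDr addNr.
Qed.

(** If [p] were negative at [x], it would be negative near [x], and [q] would have to vanish at
    infinitely many points there. *)
Lemma nonneg_cancel (p q : {poly R}) : q != 0 -> nonneg_on_itv q ->
  nonneg_on_itv (p * q) -> nonneg_on_itv p.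
Proof.
move=> nz q0 pq0 x xI; rewrite leNgt; apply/negP => /poly_lt0_near[e e0 pe].
(* The direction [u] points from [x] towards the other half of the interval, so that steps of length
   below [d <= 1] stay in [-1, 1]. *)
pose d : R := Num.min e 1; pose u : R := if x <= 0 then 1 else -1.
have d0 : 0 < d by rewrite lt_min e0 ltr01.
have de : d <= e by rewrite ge_min lexx.
have d1 : d <= 1 by rewrite ge_min lexx orbT.
pose z i := x + u * (d / i.+2%:R).
have b i : 0 < d / i.+2%:R < d.
  by rewrite divr_gt0 ?ltr0n//= ltr_pdivrMr ?ltr0n// ltr_pMr// ltr1n.
have zI i : -1 <= z i <= 1.
  have := b i; rewrite /z /u; move: (d / _) => r.
  by case: (leP x 0) => *; lra.
have ze i : `|z i - x| < e.
  rewrite /z addrC addKr normrM; have -> : `|u| = 1.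
    by rewrite /u; case: ifP => _; rewrite ?normrN normr1.
  by have /andP[b1 b2] := b i; rewrite mul1r ger0_norm ?ltW// (lt_le_trans b2).
have zq i : q.[z i] = 0.
  apply/eqP; rewrite eq_le (q0 _ (zI i)) andbT.
  by have := pq0 _ (zI i); rewrite hornerM nmulr_rge0// pe.
have /(max_poly_roots nz) : all (root q) [seq z i | i <- iota 0 (size q)].
  by apply/allP => _ /mapP[i _ ->]; rewrite /root zq.
rewrite size_map size_iota ltnn => F; suff // : false by []; apply: F.
rewrite map_inj_uniq ?iota_uniq// => i j /addrI.
have u0 : u != 0 by rewrite /u; case: ifP; rewrite ?oppr_eq0 oner_eq0.
by move=> /(mulfI u0)/(mulfI (lt0r_neq0 d0))/invr_inj/eqP; rewrite eqr_nat => /eqP[].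
Qed.

(** Write [q = p * (X - x)]. The second factor changes sign at the interior point [x], which forces
    both [0 <= p.[x]] and [p.[x] <= 0]. *)
Lemma nonneg_double_root (q : {poly R}) x : nonneg_on_itv q -> -1 < x < 1 ->
  q.[x] = 0 -> ('X - x%:P) ^+ 2 %| q.
Proof.
move=> q0 xI qx; have /factor_theorem[p pE] : root q x by apply/eqP.
suff px : p.[x] = 0.
  have /factor_theorem[r rE] : root p x by apply/eqP.
  by rewrite pE rE -mulrA -expr2 dvdp_mull.
(* The point [z = x + v * d] lies to the right of [x] for [v = 1] and to the left for [v = -1]; in
   both cases [q.[z] = f.[z] * d]. *)
have aux (v : R) (f : {poly R}) : `|v| = 1 -> (forall z, q.[z] = v * f.[z] * (z - x)) -> 0 <= f.[x].
  move=> v1 qf; rewrite leNgt; apply/negP => /poly_lt0_near[e e0 fe].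
  pose d : R := Num.min e (Num.min (x + 1) (1 - x)) / 2.
  have d0 : 0 < d by rewrite divr_gt0// !lt_min e0; apply/andP; split => //; apply/andP; split; lra.
  have [d1 d2 d3] : [/\ d < e, d <= x + 1 & d <= 1 - x].
    have : d * 2 <= e /\ d * 2 <= x + 1 /\ d * 2 <= 1 - x.
      by rewrite /d divfK// !ge_min !lexx ?orbT.
    by move=> [? [? ?]]; split; lra.
  pose z := x + v * d.
  have zx : z - x = v * d by rewrite /z addrC addKr.
  have := q0 z; rewrite qf zx (_ : v * f.[z] * (v * d) = f.[z] * (v ^+ 2 * d)); last by ring.
  rewrite -real_normK ?num_real// v1 expr1n mul1r pmulr_lge0//.
  have vd : `|v * d| = d by rewrite normrM v1 mul1r ger0_norm ?ltW.
  have fz : f.[z] < 0 by apply: fe; rewrite zx vd.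
  move=> H; suff /H : -1 <= z <= 1 by rewrite leNgt fz.
  by move: vd => /eqP; rewrite eqr_norml /z => /andP[/orP[]/eqP-> _]; lra.
apply/eqP; rewrite eq_le; apply/andP; split.
  rewrite -oppr_ge0 -hornerN; apply: (aux (-1)); first by rewrite normrN normr1.
  by move=> z; rewrite pE !hornerE; ring.
apply: (aux 1); first by rewrite normr1.
by move=> z; rewrite pE !hornerE; ring.
Qed.

End Positivity.

Section Lobatto.
Variable R : realType.
Local Notation V := (chebV R).

Lemma size_deriv_chebV n : size (V n.+1)^`() = n.
Proof.
case: n => [|n]; first by rewrite -[V 1]/(1%:P) derivC size_poly0.
by rewrite polyorder.size_deriv size_chebV.
Qed.

(** Rolle's theorem between consecutive Gauss nodes gives [n.-1] zeros. *)
Lemma deriv_chebV_roots n : exists s : seq R,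
  [/\ uniq s, size s = n.-1, {in s, forall x : R, -1 < x < 1} &
      forall x, x \in s -> root (V n.+1)^`() x].
Proof.
pose g (i : nat) : R := cos (i.+1%:R * pi / n.+1%:R).
have gin i : (i < n)%N -> g i \in gauss_nodes R n.
  by move=> h; apply/mapP; exists i; rewrite ?mem_iota.
(* The nodes [g k] decrease, so zeros are collected from right to left; the lower bound [g k] keeps
   each new zero distinct from the earlier ones. *)
suff H : forall k, (k < n)%N -> exists s : seq R,
  [/\ uniq s, size s = k, {in s, forall x : R, g k < x < 1} &
      forall x, x \in s -> root (V n.+1)^`() x].
  case: n @g gin H => [|n] g gin H; first by exists [::].
  have [s [us ss sI sr]] := H n (ltnSn n); exists s; split=> // x xs.
  have /andP[h1 _] := gauss_nodes_itv (gin _ (ltnSn n)).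
  by have /andP[h2 ->] := sI _ xs; rewrite (lt_trans h1).
elim=> [_|k IH kn]; first by exists [::].
have [s [us ss sI sr]] := IH (ltnW kn).
have [||c] := @polyrcf.poly_rolle R (g k.+1) (g k) (V n.+1).
- have [a0 a1] := cos_nodeP R (ltnW kn); have [b0 b1] := cos_nodeP R kn.
  rewrite /g ltr_cos ?in_itv /= ?ltW//.
  by rewrite ltr_pM2r ?invr_gt0 ?ltr0n// ltr_pM2r ?pi_gt0// ltr_nat.
- rewrite !(eqP (gauss_nodes_root (gin _ _)))//; exact: ltnW.
rewrite in_itv /= => /andP[c1 c2] /eqP cr.
have /andP[_ gk1] := gauss_nodes_itv (gin _ (ltnW kn)).
exists (c :: s); split=> /=.
- rewrite us andbT; apply/negP => /sI/andP[h _].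
  by have := lt_trans c2 h; rewrite ltxx.
- by rewrite ss.
- move=> x; rewrite inE => /predU1P[->|/sI/andP[h ->]]; first by rewrite c1 (lt_trans c2).
  by rewrite andbT (lt_trans c1)// (lt_trans c2).
- by move=> x; rewrite inE => /predU1P[->|/sr].
Qed.

(** The node polynomial is a multiple of [(1 - X^2) * U_m'], a combination of [V m] and [V m.+2],
    both orthogonal to polynomials of size at most [m.-1]. With [m.+1] nodes this gives exactness up
    to size [m + m]. *)
Lemma lobatto_quadrature (m : nat) : (0 < m)%N -> exists (s : seq R) (w : R -> R),
  [/\ uniq [:: 1, -1 & s], size s = m.-1, {in s, forall x : R, -1 < x < 1},
      (forall x, x \in s -> root (V m.+1)^`() x) &
      (forall x : R, x \in [:: 1, -1 & s] -> 0 < w x) /\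
      forall p : {poly R}, (size p <= m + m)%N ->
        ucoef 0 p = \sum_(x <- [:: 1, -1 & s]) w x * p.[x]].
Proof.
move=> m0; have [s [us ss sI sr]] := deriv_chebV_roots m.
set S := [:: 1, -1 & s]; pose w := weight S.
have uS : uniq S.
  rewrite /S /= !inE negb_or us andbT -andbA; apply/and3P; split.
  - by rewrite -subr_eq0 opprK; apply: lt0r_neq0.
  - by apply/negP => /sI; rewrite ltxx andbF.
  - by apply/negP => /sI; rewrite ltxx.
pose W := \prod_(x <- s) ('X - x%:P).
have WE : (V m.+1)^`() = lead_coef (V m.+1)^`() *: W.
  apply: all_roots_prod_XsubC; rewrite ?uniq_rootsE//.
    by rewrite size_deriv_chebV ss prednK.
  by apply/allP => x /sr.
have lc0 : lead_coef (V m.+1)^`() != 0.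
  by rewrite lead_coef_eq0 -size_poly_eq0 size_deriv_chebV -lt0n.
have W1 (x : R) : x \notin s -> W.[x] != 0 by move=> xs; have := root_prod_XsubC s x; rewrite /root (negbTE xs) => ->.
have Wr x : x \in s -> W.[x] = 0 by move=> xs; apply/eqP; have := root_prod_XsubC s x; rewrite /root xs.
have sW : size W = m by rewrite size_prod_XsubC ss prednK.
have exact (p : {poly R}) : (size p <= m + m)%N ->
    ucoef 0 p = \sum_(x <- S) w x * p.[x].
  move=> hp; apply: (@quadrature _ _ m.-1) => //; last first.
    by rewrite /= ss; case: (m) m0 hp => // k _; rewrite /= addnS.
  move=> q hq; rewrite !big_cons -/W.
  have -> : ('X - 1%:P) * (('X - (-1)%:P) * W) * q = - (lead_coef (V m.+1)^`())^-1 *: ((1 - 'X^2) * (V m.+1)^`() * q).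
    set l := lead_coef _ in lc0 WE *; rewrite WE -!mul_polyC !polyCN.
    have ll : (l^-1)%:P * l%:P = 1 by rewrite -polyCM mulVf.
    transitivity ((l^-1)%:P * l%:P * (('X - 1) * ('X + 1) * W * q)); last by ring.
    by rewrite ll; ring.
  rewrite ucoefZ chebV_deriv.
  (* The recurrence replaces [X * V m.+1] by [(V m + V m.+2) / 2]. *)
  have -> : (m.+2%:R * 'X * V m.+1 - m.+1%:R * V m.+2) * q =
    (m.+2%:R / 2) *: (q * V m) - (m%:R / 2) *: (q * V m.+2).
    have hh : (2^-1 : R)%:P *+ 2 = 1 by rewrite -polyCMn -[X in X%:P]mulr_natr mulVf.
    rewrite -!mul_polyC !polyCM !polyC_natr -[LHS]mulr1 -hh chebVSS -!natr1; ring.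
  have -> : V m = V m.-1.+1 by rewrite prednK.
  rewrite raddfB /= !ucoefZ !ucoef0_chebV !ucoef_big ?mulr0 ?subrr ?mulr0//.
  by rewrite (leq_trans hq)// ltnW// ltnS leq_pred.
have sW2 : (size (W ^+ 2) < m + m)%N.
  by rewrite expr2 (leq_ltn_trans (size_polyMleq _ _))// sW; lia.
have Sitv (x : R) : x \in S -> -1 <= x <= 1.
  rewrite !inE => /or3P[/eqP->|/eqP->|/sI/andP[? ?]]; lra.
have wP (x : R) (p : {poly R}) : (size p <= m + m)%N -> x \in S -> nonneg_on_itv p ->
    p.[x] != 0 -> (forall y : R, y \in S -> y != x -> p.[y] = 0) -> 0 < w x.
  move=> sp xS p0 px py; have nz : p != 0 by apply: contraNneq px => ->; rewrite horner0.
  have := ucoef0_gt0 p0 nz; rewrite exact// (bigD1_seq x)//= big_seq_cond big1 ?addr0.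
    by rewrite pmulr_lgt0// lt0r px p0// Sitv.
  by move=> y /andP[yS yx]; rewrite py// mulr0.
have h1s : 1 \notin s by case/andP: uS; rewrite inE negb_or => /andP[].
have hN1s : -1 \notin s by case/and3P: uS.
(* Each weight is tested on a polynomial that is nonnegative on [-1, 1] and vanishes at all other
   nodes: [(1 + X) W^2] for 1, [(1 - X) W^2] for -1, and [(1 - X^2)] times the square of the
   Lagrange polynomial for an inner node. *)
exists s, w; split=> //; split=> // x; rewrite !inE => /or3P[/eqP->|/eqP->|xs].
- apply: (wP _ ((1 + 'X) * W ^+ 2)); rewrite ?inE ?eqxx//.
  + rewrite (leq_trans (size_polyMleq _ _))// addrC -[1]/(1%:P) size_XaddC -[2%R]/2%N.
    by rewrite add2n.
  + move=> z zI; rewrite hornerM mulr_ge0 ?horner_exp ?sqr_ge0// !hornerE; lra.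
  + by rewrite hornerM horner_exp mulf_neq0 ?expf_neq0 ?W1// !hornerE lt0r_neq0.
  + move=> z; rewrite !inE => /or3P[/eqP->|/eqP->|/Wr W0 _]; rewrite ?eqxx// hornerM.
    by move=> _; rewrite hornerD hornerX hornerC subrr mul0r.
  by rewrite horner_exp W0 expr0n mulr0.
- apply: (wP _ ((1 - 'X) * W ^+ 2)); rewrite ?inE ?eqxx ?orbT//.
  + rewrite (leq_trans (size_polyMleq _ _))// -opprB size_polyN -[1]/(1%:P) size_XsubC.
    by rewrite add2n.
  + move=> z zI; rewrite hornerM mulr_ge0 ?horner_exp ?sqr_ge0// !hornerE; lra.
  + by rewrite hornerM horner_exp mulf_neq0 ?expf_neq0 ?W1// !hornerE opprK lt0r_neq0.
  + move=> z; rewrite !inE => /or3P[/eqP->|/eqP->|/Wr W0 _]; rewrite ?eqxx// hornerM.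
    by move=> _; rewrite hornerD hornerN hornerX hornerC subrr mul0r.
  by rewrite horner_exp W0 expr0n mulr0.
- apply: (wP _ ((1 - 'X^2) * lagrange_at s x ^+ 2)); rewrite ?inE ?xs ?orbT//.
  + rewrite (leq_trans (size_polyMleq _ _))// -opprB size_polyN size_XnsubC//.
    have : (size (lagrange_at s x ^+ 2) <= (m.-1 + m.-1).-1)%N.
      by rewrite expr2 (leq_trans (size_polyMleq _ _))// size_lagrange_at// ss.
    by move=> h; rewrite addSn /=; apply: leq_trans (leq_add (leqnn 2) h) _; lia.
  + move=> z zI; rewrite hornerM mulr_ge0 ?horner_exp ?sqr_ge0// !hornerE; nra.
  + have /andP[x1 x2] := sI _ xs.
    rewrite hornerM horner_exp mulf_neq0 ?expf_neq0 ?lagrange_at_self// !hornerE lt0r_neq0//; nra.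
  + move=> z; rewrite !inE => /or3P[/eqP->|/eqP->|zs] zx; rewrite hornerM.
    * by rewrite hornerD hornerN hornerXn hornerC expr1n subrr mul0r.
    * by rewrite hornerD hornerN hornerXn hornerC sqrrN expr1n subrr mul0r.
    * by rewrite horner_exp (lagrange_at_other zs zx) expr0n mulr0.
Qed.

End Lobatto.

(** * Extremal problem for an abstract quadrature rule *)

Section ExtremalData.
Variable R : realType.
Implicit Type Q : {poly R}.

(** For [n > 0] these are the [Q] that correspond to [T_le R n], by [T_le_tr_polyP]. Below, [n] is
    [m.*2 - 3] for odd degree and [m.*2 - 2] for even degree. *)
Definition admissible n Q :=
  [/\ nonneg_on_itv Q, (size Q <= n)%N & ucoef 0 Q = 1].

(* [sg = 1] for a maximum and [sg = -1] for a minimum. *)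
Definition extremal_data (m : nat) (sg y : R) (Q0 : {poly R}) :=
  [/\ forall Q, admissible (m.*2 - 2) Q -> sg * ucoef 2 Q <= sg * (4 * y ^+ 2 - 1),
      forall Q, (admissible (m.*2 - 2) Q /\ ucoef 2 Q = 4 * y ^+ 2 - 1) <->
        exists2 tau : R, -1 <= tau <= 1 & Q = Q0 * (1 + tau *: 'X),
      forall Q, (admissible (m.*2 - 3) Q /\ ucoef 2 Q = 4 * y ^+ 2 - 1) <-> Q = Q0
    & (size Q0 + 3 = m.*2)%N].

End ExtremalData.

(* The nodes are the zeros [sE] of [E] and [sW] of [W], where [E] is [1] for the Gauss
   rule and [1 - x^2] for the Lobatto rule. *)
Section Extremal.
Variables (R : realType) (m : nat) (sE sW : seq R) (w : R -> R).
Variables (E W Q0 : {poly R}) (c y sg : R).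
Local Notation V := (chebV R).
Local Notation s := (sE ++ sW).

Hypothesis us : uniq s.
Hypothesis sW_itv : forall x, x \in sW -> -1 < x < 1.
Hypothesis sE_itv : forall x, x \in sE -> -1 <= x <= 1.
Hypothesis E_roots : E %= \prod_(x <- sE) ('X - x%:P).
Hypothesis W_roots : W %= \prod_(x <- sW) ('X - x%:P).
Hypothesis E_ge0 : nonneg_on_itv E.
Hypothesis size_EW : (size sE + (size sW).*2 = m.*2)%N.
Hypothesis w_gt0 : forall x, x \in s -> 0 < w x.
Hypothesis quad : forall p : {poly R}, (size p <= m.*2)%N ->
  ucoef 0 p = \sum_(x <- s) w x * p.[x].
Hypothesis c_gt0 : 0 < c.
Hypothesis Q0E : ('X^2 - (y ^+ 2)%:P) ^+ 2 * Q0 = c *: (E * W ^+ 2).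
Hypothesis Q0_1 : ucoef 0 Q0 = 1.
Hypothesis Q0_even : ucoef 0 (Q0 * 'X) = 0.
Hypothesis sg1 : sg ^+ 2 = 1.
Hypothesis nodes_y : forall x, x \in s -> 0 <= sg * (y ^+ 2 - x ^+ 2).

Lemma E_neq0 : E != 0.
Proof.
by rewrite -size_poly_eq0 (eqp_size E_roots) size_prod_XsubC.
Qed.

Lemma W_neq0 : W != 0.
Proof.
by rewrite -size_poly_eq0 (eqp_size W_roots) size_prod_XsubC.
Qed.

Lemma EW_ge0 : nonneg_on_itv (c *: (E * W ^+ 2)).
Proof.
move=> x xI; rewrite hornerZ pmulr_rge0// hornerM horner_exp mulr_ge0 ?sqr_ge0//.
exact: E_ge0.
Qed.

Lemma node_factor_neq0 : ('X^2 - (y ^+ 2)%:P) ^+ 2 != 0 :> {poly R}.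
Proof. by rewrite expf_neq0// -size_poly_eq0 size_XnsubC. Qed.

Lemma node_factor_ge0 : nonneg_on_itv (('X^2 - (y ^+ 2)%:P) ^+ 2 : {poly R}).
Proof. by move=> x _; rewrite horner_exp sqr_ge0. Qed.

Lemma Q0_ge0 : nonneg_on_itv Q0.
Proof.
apply: (nonneg_cancel node_factor_neq0 node_factor_ge0).
by rewrite mulrC Q0E; exact: EW_ge0.
Qed.

Lemma Q0_neq0 : Q0 != 0.
Proof.
apply: contra_eq_neq Q0_1 => ->; rewrite raddf0.
by rewrite eq_sym oner_neq0.
Qed.

Lemma size_Q0 : (size Q0 + 3 = m.*2)%N.
Proof.
have := congr1 (fun p : {poly R} => size p) Q0E.
rewrite size_scale ?gt_eqF// [size (_ * Q0)]size_mul ?node_factor_neq0 ?Q0_neq0//.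
rewrite [size (E * _)]size_mul ?E_neq0 ?expf_neq0 ?W_neq0//.
rewrite (eqp_size E_roots) size_prod_XsubC.
have sq (p : {poly R}) : p != 0 -> size (p ^+ 2) = (size p).*2.-1.
  by move=> nz; rewrite expr2 size_mul// addnn.
have n0 : 'X^2 - (y ^+ 2)%:P != 0 :> {poly R} by rewrite -size_poly_eq0 size_XnsubC.
rewrite !sq ?W_neq0// size_XnsubC//.
rewrite (eqp_size W_roots) size_prod_XsubC => h.
have arith (q e k n : nat) : (3.*2.-1 + q).-1 = (e.+1 + k.+1.*2.-1).-1 ->
  (e + k.*2 = n.*2 -> q + 3 = n.*2)%N by lia.
exact: arith h size_EW.
Qed.

Local Notation adm := (admissible (m.*2 - 2)).

Lemma ucoef2 (Q : {poly R}) : ucoef 2 Q = 4 * ucoef 0 (Q * 'X^2) - ucoef 0 Q.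
Proof.
rewrite -ucoef0_chebV.
have -> : Q * V 3 = 4%:R *: (Q * 'X^2) - Q by rewrite /chebV scaler_nat; ring.
by rewrite raddfB /= ucoefZ.
Qed.

(** As [ucoef 0 Q = 1], the gap is [4 * ucoef 0 ((y^2 - X^2) * Q)]; the argument has size at most
    [m.*2], where the rule is exact. *)
Lemma admissible_gap (Q : {poly R}) : (size Q <= m.*2 - 2)%N -> ucoef 0 Q = 1 ->
  4 * y ^+ 2 - 1 - ucoef 2 Q = 4 * \sum_(x <- s) w x * ((y ^+ 2 - x ^+ 2) * Q.[x]).
Proof.
move=> sQ Q1; rewrite ucoef2 Q1.
have -> : 4 * y ^+ 2 - 1 - (4 * ucoef 0 (Q * 'X^2) - 1) = 4 * (y ^+ 2 * ucoef 0 Q - ucoef 0 (Q * 'X^2)).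
  by rewrite Q1; ring.
have -> : y ^+ 2 * ucoef 0 Q - ucoef 0 (Q * 'X^2) = ucoef 0 (y ^+ 2 *: Q - Q * 'X^2).
  by rewrite raddfB /= ucoefZ.
rewrite quad.
  congr (_ * _); apply: eq_bigr => x _.
  by rewrite hornerD hornerN hornerZ hornerM hornerXn; ring.
have [->|nz] := eqVneq Q 0; first by rewrite mul0r scaler0 subr0 size_poly0.
rewrite (leq_trans (size_polyD _ _))// size_polyN geq_max.
rewrite (leq_trans (size_scale_leq _ _)) ?(leq_trans sQ) ?leq_subr//=.
rewrite size_mulXn//.
have arith (a n : nat) : (0 < a -> a <= n - 2 -> 2 + a <= n)%N by lia.
by apply: arith sQ; rewrite size_poly_gt0.
Qed.

Lemma s_itv x : x \in s -> -1 <= x <= 1.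
Proof.
by rewrite mem_cat => /orP[/sE_itv//|/sW_itv/andP[? ?]]; rewrite !ltW.
Qed.

Lemma admissible_le (Q : {poly R}) : adm Q ->
  sg * ucoef 2 Q <= sg * (4 * y ^+ 2 - 1).
Proof.
case=> Qge0 sQ Q1; rewrite -subr_ge0 -mulrBr admissible_gap// mulrCA mulr_ge0//.
rewrite mulr_sumr big_seq sumr_ge0// => x xs.
rewrite mulrCA mulr_ge0 ?(ltW (w_gt0 xs))// mulrA mulr_ge0 ?nodes_y//.
by apply: Qge0; exact: s_itv.
Qed.

Lemma node_root x : x \in s -> (x ^+ 2 - y ^+ 2) * Q0.[x] = 0.
Proof.
(* Multiplying [Q0E] by [Q0] turns its left side into the square of the claimed quantity. *)
move=> xs; have := congr1 (fun p => (p * Q0).[x]) Q0E.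
have EW : (E * W ^+ 2).[x] = 0.
  move: xs; rewrite mem_cat hornerM horner_exp => /orP[] xs.
    have /eqP-> : root E x by rewrite (eqp_root E_roots) root_prod_XsubC.
    by rewrite mul0r.
  have /eqP-> : root W x by rewrite (eqp_root W_roots) root_prod_XsubC.
  by rewrite expr0n mulr0.
rewrite [in RHS]hornerM hornerZ EW mulr0 mul0r => H.
apply/eqP; rewrite -sqrf_eq0; apply/eqP; rewrite -[RHS]H !hornerE; ring.
Qed.

Lemma extremal_Q0 (tau : R) : -1 <= tau <= 1 ->
  adm (Q0 * (1 + tau *: 'X)) /\
  ucoef 2 (Q0 * (1 + tau *: 'X)) = 4 * y ^+ 2 - 1.
Proof.
move=> tI; set Q := Q0 * _.
have Q1 : ucoef 0 Q = 1.
  by rewrite /Q mulrDr mulr1 -scalerAr raddfD /= ucoefZ Q0_1 Q0_even mulr0 addr0.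
have sQ : (size Q <= m.*2 - 2)%N.
  rewrite (leq_trans (size_polyMleq _ _))//.
  have s2 : (size (1 + tau *: 'X)%R <= 2)%N.
    rewrite (leq_trans (size_polyD _ _))// geq_max size_poly1 /=.
    by rewrite (leq_trans (size_scale_leq _ _))// size_polyX.
  have arith (a b n : nat) : (a + 3 = n -> b <= 2 -> (a + b).-1 <= n - 2)%N by lia.
  exact: arith size_Q0 s2.
have Qge0 : nonneg_on_itv Q.
  move=> x xI; rewrite !hornerE mulr_ge0//; first exact: Q0_ge0.
  by nra.
split=> //; apply/esym/eqP; rewrite -subr_eq0 admissible_gap// mulf_eq0.
apply/orP; right; apply/eqP; rewrite big_seq big1// => x xs.
rewrite /Q hornerM (_ : _ * _ = - (w x * (1 + tau *: 'X).[x]) * ((x ^+ 2 - y ^+ 2) * Q0.[x])); last by ring.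
by rewrite node_root// mulr0.
Qed.

(* All nodes are zeros of [(x^2 - y^2)^2 Q], double ones for those inside the
   interval, so [E W^2], hence [Q0], divides. *)
Lemma extremal_dvd (Q : {poly R}) : adm Q ->
  ucoef 2 Q = 4 * y ^+ 2 - 1 -> Q0 %| Q.
Proof.
move=> [Qge0 sQ Q1] Q2; pose F := ('X^2 - (y ^+ 2)%:P) ^+ 2 * Q.
have Fge0 : nonneg_on_itv F.
  by move=> x xI; rewrite hornerM mulr_ge0 ?node_factor_ge0//; exact: Qge0.
have Froot x : x \in s -> F.[x] = 0.
  move=> xs; have H : \sum_(x <- s) w x * ((sg * (y ^+ 2 - x ^+ 2)) * Q.[x]) = 0.
    have := admissible_gap sQ Q1; rewrite Q2 subrr => /esym/eqP.
    rewrite mulf_eq0 pnatr_eq0 /= => /eqP S0.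
    transitivity (sg * \sum_(x <- s) w x * ((y ^+ 2 - x ^+ 2) * Q.[x])).
      by rewrite mulr_sumr; apply: eq_bigr => z _; ring.
    by rewrite S0 mulr0.
  move/eqP: H; rewrite big_seq psumr_eq0 => [/allP/(_ _ xs)|z zs]; last first.
    rewrite mulr_ge0 ?(ltW (w_gt0 zs))// mulr_ge0 ?nodes_y//.
    by apply: Qge0; exact: s_itv.
  rewrite xs /= mulf_eq0 gt_eqF ?w_gt0//= => /eqP H.
  transitivity (sg * (x ^+ 2 - y ^+ 2) * - (sg * (y ^+ 2 - x ^+ 2) * Q.[x])).
    by rewrite !hornerE -[LHS]mul1r -sg1; ring.
  by rewrite H oppr0 mulr0.
pose PW := \prod_(x <- sW) ('X - x%:P); pose PE := \prod_(x <- sE) ('X - x%:P).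
have uW : uniq sW by move: us; rewrite cat_uniq => /and3P[].
have uE : uniq sE by move: us; rewrite cat_uniq => /and3P[].
have /dvdpP[G FG] : PW %| F.
  apply: uniq_roots_dvdp; rewrite ?uniq_rootsE//.
  by apply/allP => x xs; apply/eqP/Froot; rewrite mem_cat xs orbT.
have /dvdpP[H GH] : PW %| G.
  apply: uniq_roots_dvdp; rewrite ?uniq_rootsE//; apply/allP => x xs.
  have := nonneg_double_root Fge0 (sW_itv xs).
  rewrite Froot ?mem_cat ?xs ?orbT// => /(_ erefl).
  rewrite FG /PW (prod_lagrange_at uW xs) mulrCA expr2 dvdp_mul2l ?polyXsubC_eq0//.
  rewrite dvdp_XsubCl /root hornerM mulf_eq0 (negbTE (lagrange_at_self _ _)) orbF//.
have /dvdpP[K HK] : PE %| H.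
  apply: uniq_roots_dvdp; rewrite ?uniq_rootsE//; apply/allP => x xs.
  have /eqP : F.[x] = 0 by rewrite Froot// mem_cat xs.
  rewrite FG GH !hornerM !mulf_eq0 -/(root H x).
  have : x \notin sW by move: us; rewrite cat_uniq => /and3P[_ /hasPn/(_ x)/contraL -> //]; rewrite negbK.
  by rewrite -(root_prod_XsubC sW) /root => /negbTE ->; rewrite !orbF.
have d : ('X^2 - (y ^+ 2)%:P) ^+ 2 * Q0 %| F.
  rewrite Q0E FG GH HK dvdpZl ?gt_eqF// -!mulrA expr2.
  by rewrite dvdp_mull// !dvdp_mul// ?(eqp_dvdl _ E_roots) ?(eqp_dvdl _ W_roots).
by move: d; rewrite /F dvdp_mul2l// node_factor_neq0.
Qed.

(** By [extremal_dvd] and the sizes, [Q = Q0 * L] with [L] of degree at most 1. The normalization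
    gives the constant term 1, as [Q0 * X] has integral 0, and [L >= 0] at 1 and -1 bounds the
    slope. *)
Lemma extremal_admissible (Q : {poly R}) :
  (adm Q /\ ucoef 2 Q = 4 * y ^+ 2 - 1) <->
  exists2 tau : R, -1 <= tau <= 1 & Q = Q0 * (1 + tau *: 'X).
Proof.
split; last by move=> [tau tI ->]; exact: extremal_Q0.
move=> [Qa Q2]; have [Qge0 sQ Q1] := Qa.
have /dvdpP[L QL] := extremal_dvd Qa Q2.
have L0 : L != 0.
  by apply: contra_eq_neq Q1 => L0; rewrite QL L0 mul0r raddf0 eq_sym oner_neq0.
have sL : (size L <= 2)%N.
  move: sQ; rewrite QL size_mul ?Q0_neq0// => h.
  have arith (a b n : nat) : (a + 3 = n -> (b + a).-1 <= n - 2 -> b <= 2)%N by lia.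
  exact: arith size_Q0 h.
have LE : L = (L`_0)%:P + L`_1 *: 'X.
  apply/polyP => i; rewrite coefD coefC coefZ coefX.
  case: i => [|[|i]]; rewrite ?mulr0 ?mulr1 ?addr0 ?add0r//.
  by rewrite nth_default// (leq_trans sL).
have L01 : L`_0 = 1.
  move: Q1; rewrite QL [in X in X -> _]LE mulrDl mul_polyC -scalerAl raddfD /= !ucoefZ Q0_1.
  by rewrite ['X * Q0]mulrC Q0_even mulr0 addr0 mulr1.
rewrite L01 in LE; exists L`_1; last by rewrite {1}QL mulrC {1}LE.
have Lge0 : nonneg_on_itv L.
  by apply: (nonneg_cancel Q0_neq0 Q0_ge0); rewrite -QL.
have := Lge0 1; have := Lge0 (-1); rewrite LE !hornerE /= => H1 H2.
have {}H1 : 0 <= 1 + L`_1 * -1 by apply: H1; lra.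
have {}H2 : 0 <= 1 + L`_1 by apply: H2; lra.
rewrite -LE; lra.
Qed.

(** A size bound smaller by one leaves no room for the linear factor, hence [tau = 0]. *)
Lemma extremal_admissible_odd (Q : {poly R}) :
  (admissible (m.*2 - 3) Q /\ ucoef 2 Q = 4 * y ^+ 2 - 1) <-> Q = Q0.
Proof.
have tau0 : Q0 = Q0 * (1 + 0 *: 'X) by rewrite scale0r addr0 mulr1.
have I0 : -1 <= (0 : R) <= 1 by rewrite lerN10 ler01.
have [[Q0ge0 _ _] Q02] := extremal_Q0 I0; rewrite -tau0 in Q0ge0 Q02.
split=> [[[Qge0 sQ Q1] Q2]|->]; last first.
  have arith (a n : nat) : (a + 3 = n -> a <= n - 3)%N by lia.
  by split=> //; split=> //; exact: arith size_Q0.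
have sQ' : (size Q <= m.*2 - 2)%N by rewrite (leq_trans sQ)// leq_sub2l.
have [tau _ QE] := (extremal_admissible Q).1 (conj (And3 Qge0 sQ' Q1) Q2).
suff t0 : tau = 0 by rewrite QE t0 -tau0.
apply/eqP/negPn/negP => t0.
have s2 : size (1 + tau *: 'X)%R = 2.
  by rewrite addrC size_polyDl ?size_scale ?size_polyX// size_poly1.
move: sQ; rewrite QE size_mul ?Q0_neq0 -?size_poly_eq0 ?s2// => h.
have arith (a n : nat) : (a + 3 = n -> (a + 2).-1 <= n - 3 -> False)%N by lia.
exact: arith size_Q0 h.
Qed.

Lemma extremal_summary : extremal_data m sg y Q0.
Proof.
split; [exact: admissible_le|exact: extremal_admissible|
  exact: extremal_admissible_odd|exact: size_Q0].
Qed.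

End Extremal.

(** * Typically real polynomials *)

Section ComplexParts.
Variable R : realType.
Implicit Types z w : R[i].

Lemma cImD z w : complex.Im (z + w) = complex.Im z + complex.Im w.
Proof. by case: z w => [a b] [c d]. Qed.

Lemma cImZ (r : R) z : complex.Im (r%:C * z) = r * complex.Im z.
Proof. by case: z => a b /=; rewrite mul0r addr0. Qed.

Lemma cIm_sum (I : Type) (s : seq I) (F : I -> R[i]) :
  complex.Im (\sum_(i <- s) F i) = \sum_(i <- s) complex.Im (F i).
Proof. by elim/big_rec2: _ => // i x y _ <-; rewrite cImD. Qed.

Lemma norm_cIm z : `|complex.Im z|%:C <= `|z|.
Proof.
case: z => a b; rewrite normc_def lecR /= -sqrtr_sqr ler_wsqrtr// lerDr sqr_ge0 //.
Qed.

Lemma complex_normE z : exists2 r : R, 0 <= r & `|z| = r%:C.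
Proof. by rewrite normc_def; eexists; last by []; exact: sqrtr_ge0. Qed.

Lemma horner_derivable (p : {poly R[i]}) z : derivable (horner p : R[i]^o -> R[i]^o) z 1.
Proof.
elim/poly_ind: p => [|p c IH].
  have -> : (horner (0 : {poly R[i]}) : R[i]^o -> R[i]^o) = cst 0.
    by apply/funext => x; rewrite horner0.
  exact: derivable_cst.
have -> : (horner (p * 'X + c%:P) : R[i]^o -> R[i]^o) =
    (horner p : R[i]^o -> R[i]^o) * (id : R[i]^o -> R[i]^o) + cst c.
  by apply/funext => x; rewrite hornerMXaddC.
apply: derivableD; last exact: derivable_cst.
exact: (@derivableM R[i] R[i]^o (horner p) id _ _ IH (@derivable_id _ _ _ _)).
Qed.

End ComplexParts.

Section TypicallyRealPolynomials.
Variable R : realType.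
Local Notation V := (chebV R).

(** The polynomial [P] with [Im P(e^(it)) = sin t * Q(cos t)]: the coefficient of [U_j] in [Q]
    becomes that of [z^(j+1)]. *)
Definition tr_poly (Q : {poly R}) : {poly R[i]} :=
  map_poly (real_complex R) ('X * \poly_(j < size Q) ucoef j Q).

Lemma coef_tr_poly0 Q : (tr_poly Q)`_0 = 0.
Proof. by rewrite coef_map coefXM. Qed.

Lemma coef_tr_polyS Q j : (tr_poly Q)`_j.+1 = (ucoef j Q)%:C.
Proof.
rewrite coef_map coefXM coef_poly /=; case: ltnP => // h.
by rewrite ucoef_big.
Qed.

Lemma size_tr_poly (Q : {poly R}) n : (size Q <= n)%N -> (size (tr_poly Q) <= n.+1)%N.
Proof.
move=> h; apply/leq_sizeP => -[//|j] nj.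
by rewrite coef_tr_polyS ucoef_big// (leq_trans h).
Qed.

Lemma horner_tr_poly (Q : {poly R}) n z : (size Q <= n)%N ->
  (tr_poly Q).[z] = \sum_(j < n) (ucoef j Q)%:C * z ^+ j.+1.
Proof.
move=> h; rewrite (horner_coef_wide _ (size_tr_poly h)) big_ord_recl.
rewrite coef_tr_poly0 mul0r add0r; apply: eq_bigr => j _.
by rewrite lift0 coef_tr_polyS.
Qed.

(* Truncated generating function of the [U_j]; at a zero of [U_n] the
   numerator of the remainder is [U_(n-1) z^(n+2)], with [U_(n-1) = +-1]. *)
Lemma sum_chebV_generating n (x : R) (z : R[i]) :
  (1 - (2 * x)%:C * z + z ^+ 2) * (\sum_(j < n) ((V j.+1).[x])%:C * z ^+ j.+1) =
  z - ((V n.+1).[x])%:C * z ^+ n.+1 + ((V n).[x])%:C * z ^+ n.+2.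
Proof.
elim: n => [|n IH].
  by rewrite big_ord0 -[V 1]/(1%:P) -[V 0]/(0%:P) !hornerC rmorph1 rmorph0; ring.
rewrite big_ord_recr /= mulrDr IH hchebVSS rmorphB rmorphM /= !exprS; ring.
Qed.

(** At a zero of [U_n] the sum is [S = (z +- z^(n+2)) / D] with [D = 1 - 2 x z + z^2]. Then
    [|D|^2 Im S] is [Im (z * conjc D) = b (1 - r^2)] plus an error of modulus at most [4 r^(n+2)],
    because [|D| <= 4]. *)
Lemma kernel_Im_gt0 n (x : R) (z : R[i]) (b r : R) :
  root (V n.+1) x -> -1 <= x <= 1 ->
  b = complex.Im z -> `|z| = r%:C -> r < 1 ->
  4 * r ^+ n.+2 < `|b| * (1 - r ^+ 2) ->
  0 < b * complex.Im (\sum_(j < n) ((V j.+1).[x])%:C * z ^+ j.+1).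
Proof.
move=> rx xI bE zr r1 hn; set S := \sum_(j < n) _.
have r0 : 0 <= r by rewrite -ler0c -zr.
have b0 : 0 < `|b|.
  rewrite normr_gt0; apply: contraTneq hn => ->; rewrite normr0 mul0r -leNgt.
  by rewrite mulr_ge0 ?exprn_ge0.
pose D : R[i] := 1 - (2 * x)%:C * z + z ^+ 2.
have e1 : ((V n).[x]) ^+ 2 = 1.
  have := chebV_pell n x; rewrite (eqP rx) expr0n /= mulr0 mul0r subr0 add0r.
  by [].
have SD : D * S = z + ((V n).[x])%:C * z ^+ n.+2.
  by rewrite /D /S sum_chebV_generating (eqP rx) mul0r subr0.
have [d d0 Dd] := complex_normE D.
have d4 : d <= 4.
  rewrite -lecR -Dd /D (le_trans (ler_normD _ _))//.
  rewrite (le_trans (lerD (ler_normB _ _) (lexx _)))// normr1 normrM normrX zr.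
  have -> : `|(2 * x)%:C| = (`|2 * x|)%:C :> R[i].
    by rewrite normc_def /= expr0n addr0 sqrtr_sqr.
  rewrite -!(rmorphM, rmorphXn, rmorphD, rmorph1 (real_complex R)) /= lecR.
  have x1 : `|x| <= 1 by rewrite ler_norml.
  rewrite normrM ger0_norm//; have := normr_ge0 x; nra.
have DD : D * conjc D = (d ^+ 2)%:C by rewrite -sqr_normc Dd rmorphXn.
have main : d ^+ 2 * complex.Im S =
    b * (1 - r ^+ 2) + (V n).[x] * complex.Im (z ^+ n.+2 * conjc D).
  rewrite -cImZ -DD mulrAC SD mulrDl cImD -mulrA cImZ; congr (_ + _).
  have zz : z * conjc z = (r ^+ 2)%:C by rewrite -sqr_normc zr rmorphXn.
  have -> : z * conjc D = z - (2 * x * r ^+ 2)%:C + (r ^+ 2)%:C * conjc z.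
    have -> : conjc D = 1 - (2 * x)%:C * conjc z + conjc z ^+ 2.
      rewrite /D !expr2; case: (z) => u v.
      by apply/eqP; rewrite eq_complex /=; apply/andP; split; apply/eqP; ring.
    have -> : (2 * x * r ^+ 2)%:C = (2 * x)%:C * (z * conjc z) by rewrite zz rmorphM.
    rewrite -zz.
    by move: (conjc z) (real_complex R (2 * x)) => u v /=; ring.
  rewrite !cImD cImZ bE; case: (z) => u v /=; ring.
have errb : `|(V n).[x] * complex.Im (z ^+ n.+2 * conjc D)| <= 4 * r ^+ n.+2.
  have -> : 4 * r ^+ n.+2 = 1 * (r ^+ n.+2 * 4) by ring.
  rewrite normrM ler_pM// ?normr_ge0//.
    by move/eqP: e1; rewrite sqrf_eq1 => /orP[]/eqP->; rewrite ?normrN normr1.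
  rewrite -lecR (le_trans (norm_cIm _))// normrM normrX normcJ zr Dd.
  by rewrite -rmorphXn -rmorphM /= lecR ler_wpM2l ?exprn_ge0.
(* If [D] were 0, the main term would be minus the error, against [hn]. *)
have dgt : 0 < d.
  rewrite lt_neqAle d0 andbT eq_sym; apply: contraTneq hn => dz.
  move: main; rewrite dz expr0n mul0r => /esym/eqP; rewrite addr_eq0 => /eqP H.
  rewrite -leNgt (le_trans _ errb)// -[X in _ <= X]normrN -H normrM.
  by rewrite ler_wpM2l// ler_norm.
have : 0 < d ^+ 2 * (b * complex.Im S).
  rewrite mulrCA main mulrDr mulrA -expr2 -real_normK ?num_real// expr2 -mulrA.
  set e := (V n).[x] * _ in errb *.
  have : - (`|b| * (4 * r ^+ n.+2)) <= b * e.
    rewrite lerNl (le_trans (ler_norm _))// normrN normrM ler_wpM2l//.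
  have : `|b| * (4 * r ^+ n.+2) < `|b| * (`|b| * (1 - r ^+ 2)) by rewrite ltr_pM2l.
  lra.
by rewrite pmulr_rgt0// exprn_gt0.
Qed.

Lemma tr_poly_Im_gt0 (Q : {poly R}) z : nonneg_on_itv Q -> Q != 0 ->
  `|z| < 1 -> complex.Im z != 0 -> 0 < complex.Im (tr_poly Q).[z] * complex.Im z.
Proof.
move=> Q0 nz z1 z0; have [r r0 zr] := complex_normE z.
have r1 : r < 1 by move: z1; rewrite zr -ltcR.
have e0 : 0 < `|complex.Im z| * (1 - r ^+ 2) / 4.
  by rewrite divr_gt0// mulr_gt0 ?normr_gt0// subr_gt0 expr_lt1.
(* The first bound makes the Gauss rule exact on [Q * U_j] for [j < n] and keeps [Q] from vanishing
   at all nodes; the second makes every kernel positive. *)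
have [n nQ hn] : exists2 n, (size Q <= n)%N & 4 * r ^+ n.+2 < `|complex.Im z| * (1 - r ^+ 2).
  have nr : `|r| < 1 by rewrite ger0_norm.
  have /cvgrPdist_lt/(_ _ e0)[k _ Hk] := cvg_expr nr.
  exists (maxn k (size Q)); first by rewrite leq_maxr.
  have := Hk (maxn k (size Q)).+2; rewrite /= sub0r normrN ger0_norm ?exprn_ge0//.
  rewrite ltr_pdivlMr// mulrC; apply.
  by rewrite (leq_trans (leq_maxl k (size Q)))// ltnW// ltnW.
pose s := gauss_nodes R n; pose w := weight s.
pose S (x : R) := \sum_(j < n) ((V j.+1).[x])%:C * z ^+ j.+1.
have xI x : x \in s -> -1 <= x <= 1 by move=> /gauss_nodes_itv/andP[*]; rewrite !ltW.
have -> : (tr_poly Q).[z] = \sum_(x <- s) (w x * Q.[x])%:C * S x.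
  rewrite (horner_tr_poly _ nQ).
  under [RHS]eq_bigr => x _ do rewrite mulr_sumr.
  rewrite exchange_big /=; apply: eq_bigr => j _.
  under eq_bigr => x _ do rewrite mulrA -rmorphM /=.
  rewrite -mulr_suml -rmorph_sum /= -ucoef0_chebV (@gauss_quadrature _ n).
    by congr ((_)%:C * _); apply: eq_bigr => x _; rewrite hornerM mulrA.
  rewrite (leq_trans (size_polyMleq _ _))// size_chebV addnS /=.
  exact: leq_add nQ (ltnW (ltn_ord j)).
rewrite cIm_sum mulr_suml big_seq.
have K x : x \in s -> 0 < complex.Im (S x) * complex.Im z.
  move=> xs; rewrite mulrC; apply: (@kernel_Im_gt0 n x z _ r) => //; last exact: xI.
  exact: gauss_nodes_root.
have T x : x \in s -> 0 <= complex.Im ((w x * Q.[x])%:C * S x) * complex.Im z.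
  move=> xs; rewrite cImZ -(mulrA (w x * Q.[x])); apply: mulr_ge0; last exact/ltW/K.
  apply: mulr_ge0; first exact/ltW/gauss_weight_gt0.
  exact/Q0/xI.
rewrite lt0r sumr_ge0// andbT; apply/negP; rewrite psumr_eq0// => /allP H.
have /(max_poly_roots nz) : all (root Q) s.
  apply/allP => x xs; move/(_ _ xs): H; rewrite xs /= cImZ -(mulrA (w x * Q.[x])) mulf_eq0.
  by rewrite (gt_eqF (K _ xs)) orbF mulf_eq0 (gt_eqF (gauss_weight_gt0 xs)).
by rewrite gauss_nodes_uniq size_gauss_nodes ltnNge nQ => /(_ isT).
Qed.

Lemma tr_poly_typically_real (Q : {poly R}) : nonneg_on_itv Q -> Q != 0 ->
  typically_real (horner (tr_poly Q)).
Proof.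
move=> Q0 nz; split=> [z _|z _ z0|z]; first exact: horner_derivable.
  have -> : z = (complex.Re z)%:C by case: z z0 => a b /= ->.
  by rewrite horner_map.
exact: tr_poly_Im_gt0.
Qed.

Lemma expr_cos_sin (r t : R) n : (r%:C * (cos t +i* sin t)) ^+ n =
  (r ^+ n)%:C * (cos (n%:R * t) +i* sin (n%:R * t)).
Proof.
elim: n => [|n IH]; first by rewrite !expr0 mul0r cos0 sin0 mul1r.
rewrite exprS IH -natr1 mulrDl mul1r cosD sinD exprS rmorphM /=.
apply/eqP; rewrite eq_complex /=; apply/andP; split; apply/eqP; ring.
Qed.

(** The polynomial formed by the imaginary parts of the coefficients vanishes at the real points
    [1 / (i + 2)] of the disk, hence identically. *)
Lemma typically_real_real_coefs (P : {poly R[i]}) : typically_real (horner P) ->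
  exists p : {poly R}, P = map_poly (real_complex R) p.
Proof.
case=> _ H _.
have [pr rE] : exists p : {poly R}, forall i, p`_i = complex.Re P`_i.
  exists (\poly_(i < size P) complex.Re P`_i) => i.
  by rewrite coef_poly; case: ltnP => // h; rewrite nth_default.
have [pi iE] : exists p : {poly R}, forall i, p`_i = complex.Im P`_i.
  exists (\poly_(i < size P) complex.Im P`_i) => i.
  by rewrite coef_poly; case: ltnP => // h; rewrite nth_default.
have PE : P = map_poly (real_complex R) pr + 'i%C *: map_poly (real_complex R) pi.
  by apply/polyP => i; rewrite coefD coefZ !coef_map rE iE; exact: complexE.
suff pi0 : pi = 0 by exists pr; rewrite PE pi0 rmorph0 scaler0 addr0.
apply/eqP/negPn/negP => nz.
pose x i : R := i.+2%:R^-1.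
have /(max_poly_roots nz) : all (root pi) [seq x i | i <- iota 0 (size pi)].
  apply/allP => _ /mapP[i _ ->]; apply/eqP.
  have x1 : unit_disk (x i)%:C.
    rewrite /unit_disk /= normc_def /= expr0n addr0 sqrtr_sqr -[1]/(1%:C) ltcR.
    by rewrite ger0_norm ?invr_ge0// invf_lt1 ?ltr0n// ltr1n.
  have := H _ x1 erefl; rewrite PE hornerD hornerZ !horner_map /=.
  by rewrite !(mul0r, mulr0, add0r, subr0, mul1r).
rewrite size_map size_iota ltnn => F; suff // : false by []; apply: F.
by rewrite map_inj_uniq ?iota_uniq// => i j /invr_inj/eqP; rewrite eqr_nat => /eqP[].
Qed.

(** Along the radius through [e^(it)], [Im P(r e^(it)) / sin t] is positive for [0 < r < 1] and
    tends to [Q(cos t)] as [r] tends to 1. *)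
Lemma typically_real_nonneg (Q : {poly R}) :
  typically_real (horner (tr_poly Q)) -> nonneg_on_itv Q.
Proof.
case=> _ _ H.
have open x : -1 < x < 1 -> 0 <= Q.[x].
  move=> /andP[x1 x2]; pose t := acos x.
  have xI : x \in `[-1, 1] by rewrite in_itv /= !ltW.
  have st : 0 < sin t by rewrite sin_acos ?ltW// sqrtr_gt0 subr_gt0; nra.
  (* As a polynomial in the radius, [h.[r] * sin t = Im P(r e^(it))], and [h.[1] = Q.[x]]. *)
  pose h : {poly R} := \sum_(j < size Q) (ucoef j Q * (V j.+1).[x]) *: 'X^(j.+1)%N.
  have h1 : h.[1] = Q.[x].
    rewrite [in RHS](chebV_expansion (leqnn (size Q))) !horner_sum.
    by apply: eq_bigr => j _; rewrite !hornerZ hornerXn expr1n mulr1.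
  rewrite -h1 leNgt; apply/negP => /poly_lt0_near[e e0 he].
  pose r : R := 1 - Num.min e 1 / 2.
  have m0 : 0 < Num.min e 1 by rewrite lt_min e0 ltr01.
  have m1 : Num.min e 1 <= 1 by rewrite ge_min lexx orbT.
  have me : Num.min e 1 <= e by rewrite ge_min lexx.
  have [r0 r1] : 0 < r /\ r < 1 by rewrite /r; split; lra.
  pose z : R[i] := r%:C * (cos t +i* sin t).
  have zr : `|z| = r%:C.
    rewrite normrM !normc_def /= cos2Dsin2 sqrtr1 mulr1 expr0n addr0 sqrtr_sqr.
    by rewrite ger0_norm// ltW.
  have zI : complex.Im z = r * sin t by rewrite cImZ.
  have zd : unit_disk z by rewrite /unit_disk /= zr -[1]/(1%:C) ltcR.
  have := H z zd; rewrite zI => /(_ (lt0r_neq0 (mulr_gt0 r0 st))).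
  rewrite pmulr_lgt0 ?mulr_gt0// (horner_tr_poly _ (leqnn _)) cIm_sum.
  have -> : \sum_(j < size Q) complex.Im ((ucoef j Q)%:C * z ^+ j.+1) = h.[r] * sin t.
    rewrite horner_sum mulr_suml; apply: eq_bigr => j _.
    rewrite cImZ expr_cos_sin cImZ /= hornerZ hornerXn -chebV_cos acosK//.
    by ring.
  rewrite pmulr_lgt0// ltNge le_eqVlt he ?orbT//.
  by rewrite /r addrC addKr normrN ger0_norm; lra.
(* The endpoints follow by continuity: a negative value at [x] would persist at [x * (1 - d)], which
   is inside the open interval. *)
move=> x xI; rewrite leNgt; apply/negP => /poly_lt0_near[e e0 he].
pose d := Num.min e 1 / 2.
have m0 : 0 < Num.min e 1 by rewrite lt_min e0 ltr01.
have m1 : Num.min e 1 <= 1 by rewrite ge_min lexx orbT.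
have me : Num.min e 1 <= e by rewrite ge_min lexx.
have := open (x * (1 - d)).
rewrite leNgt he; last first.
  rewrite mulrBr mulr1 addrAC subrr add0r normrN normrM.
  have : `|x| <= 1 by rewrite ler_norml.
  rewrite [`|d|]ger0_norm /d; have := normr_ge0 x; nra.
by move=> F; suff // : false by []; apply: F; rewrite /d; nra.
Qed.

Lemma T_le_tr_polyP N (P : {poly R[i]}) : (0 < N)%N ->
  T_le R N P <-> exists Q : {poly R},
    [/\ nonneg_on_itv Q, (size Q <= N)%N, ucoef 0 Q = 1 & P = tr_poly Q].
Proof.
move=> N0; split.
  move=> [[sP P0 P1] Ptr]; have [p pE] := typically_real_real_coefs Ptr.
  pose Q := \sum_(j < N) p`_j.+1 *: V j.+1.
  have sQ : (size Q <= N)%N.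
    apply: (big_ind (fun q : {poly R} => (size q <= N)%N)).
    - by rewrite size_poly0.
    - by move=> a b ha hb; rewrite (leq_trans (size_polyD _ _))// geq_max ha.
    - by move=> j _; rewrite (leq_trans (size_scale_leq _ _))// size_chebV.
  have Qc j : (j < N)%N -> ucoef j Q = p`_j.+1.
    move=> jN; rewrite /Q raddf_sum /= (bigD1 (Ordinal jN))//= ucoefZ ucoef_chebV eqxx mulr1.
    rewrite big1 ?addr0// => k kj; rewrite ucoefZ ucoef_chebV.
    by rewrite eq_sym -(inj_eq val_inj) /= in kj; rewrite (negbTE kj) mulr0.
  have PQ : P = tr_poly Q.
    apply/polyP => -[|j]; first by rewrite coef_tr_poly0.
    rewrite coef_tr_polyS; have [jN|jN] := ltnP j N; first by rewrite Qc// pE coef_map.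
    by rewrite nth_default ?(leq_trans sP)// ucoef_big// (leq_trans sQ).
  exists Q; split=> //; first by apply: typically_real_nonneg; rewrite -PQ.
  by apply: complexI; rewrite -coef_tr_polyS -PQ.
move=> [Q [Q0 sQ Q1 ->]]; split; first split.
- exact: size_tr_poly.
- exact: coef_tr_poly0.
- by rewrite coef_tr_polyS Q1.
apply: tr_poly_typically_real => //.
by apply: contra_eq_neq Q1 => ->; rewrite raddf0 eq_sym oner_neq0.
Qed.

Lemma T_T_leP N (P : {poly R[i]}) : T R N P <-> T_le R N P /\ P`_N != 0.
Proof. by split=> [[? ? ?]|[[? ?] ?]]. Qed.

End TypicallyRealPolynomials.

(** * The coefficients A_k *)

Section InteriorNodes.
Variable R : realType.
Local Notation V := (chebV R).
Implicit Types (a : nat -> R) (y : R).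

(* Multiplication by [4 (x^2 - y^2)] on the coefficients [a k] of [U_(2k)],
   with [a (-1) = - a 0]. *)
Definition shiftL y a (k : nat) : R :=
  if k is k'.+1 then a k'.+2 + a k' - (4 * y ^+ 2 - 2) * a k
  else a 1 - (4 * y ^+ 2 - 1) * a 0.

(** This uses [4 x^2 U_(2k) = U_(2k+2) + 2 U_(2k) + U_(2k-2)] with [U_(-2) = - U_0]. The last two
    terms come from cutting the sum at [n]. *)
Lemma shiftL_sum y a n :
  ('X^2 - (y ^+ 2)%:P) *+ 4 * (\sum_(k < n.+1) a k *: V k.*2.+1) =
  \sum_(k < n.+1) shiftL y a k *: V k.*2.+1 + a n *: V n.*2.+3 - a n.+1 *: V n.*2.+1.
Proof.
have C := (polyCB, polyCD, polyCM, polyCN, polyC_exp, polyC_natr, polyC1).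
elim: n => [|n IH].
  rewrite !big_ord1 /= -!mul_polyC !C double0 !chebVSS.
  by rewrite -[V 1]/(1 : {poly R}) -[V 0]/(0 : {poly R}); ring.
rewrite big_ord_recr /= mulrDr IH [in RHS]big_ord_recr /= !doubleS.
rewrite -!mul_polyC !C (chebVSS _ n.*2.+3) (chebVSS _ n.*2.+2) (chebVSS _ n.*2.+1); ring.
Qed.

(* [A_(2k+1)], with [al] for [alpha_N], [p = U_(2k) y] and [q = U_(2k-1) y]. *)
Definition A_seq (al y : R) (k : nat) : R :=
  let p := (V k.*2.+1).[y] in let q := (V k.*2).[y] in
  p + al * (y / (1 - y ^+ 2)) *
    (y + q * ((3 * y ^+ 2 - 1) / (2 * y ^+ 2))
       - p * ((k%:R * (1 - y ^+ 2) + y ^+ 2) / y)).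

Lemma hchebV_deriv n y :
  (1 - y ^+ 2) * (V n)^`().[y] = n.+1%:R * y * (V n).[y] - n%:R * (V n.+1).[y].
Proof.
have := congr1 (horner^~ y) (chebV_deriv R n).
by rewrite -!polyC_natr !(hornerXn, hornerD, hornerN, hornerM, hornerC, hornerX).
Qed.

Section Fixed.
Variables (m : nat) (y : R).
Hypothesis y0 : y != 0.
Hypothesis y1 : 1 - y ^+ 2 != 0.
Hypothesis yr : root (V m.+1) y.

Local Notation M := m.+1.
Local Notation al := (M%:R^-1 : R).
Local Notation A := (A_seq al y).
Local Notation v k := ((V k).[y]).

Lemma A_seq_shift k : shiftL y A k = 4 * al * y * (y - y * v k.*2.+1 + v k.*2).
Proof.
case: k => [|k]; rewrite /shiftL /A_seq ?doubleS !hchebVSS.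
  rewrite -[V 1]/(1 : {poly R}) -[V 0]/(0 : {poly R}) hornerC horner0.
  by field; rewrite y0 y1 nat1r pnatr_eq0.
move: (v k.*2.+1) (v k.*2) => p q; rewrite -!natr1.
by field; rewrite y0 y1 natr1 pnatr_eq0.
Qed.

Lemma A_seq_shift2 k : shiftL y (shiftL y A) k = 16 * al * y ^+ 2 * (1 - y ^+ 2).
Proof.
rewrite (_ : shiftL y A = fun k => 4 * al * y * (y - y * v k.*2.+1 + v k.*2)).
  case: k => [|k]; rewrite /shiftL ?doubleS !hchebVSS.
    by rewrite double0 -[V 1]/(1 : {poly R}) -[V 0]/(0 : {poly R}) hornerC horner0; ring.
  by move: (v k.*2.+1) (v k.*2) => p q; ring.
by apply/funext => j; exact: A_seq_shift.
Qed.

Lemma chebV_after_root_sqr : v M.+1 ^+ 2 = 1.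
Proof. by have := chebV_pell M y; rewrite (eqP yr) mulr0 subr0 expr0n addr0. Qed.

Lemma chebV_before_root_sqr : v m ^+ 2 = 1.
Proof. by have := chebV_pell m y; rewrite (eqP yr) mulr0 mul0r subr0 expr0n add0r. Qed.

Lemma chebV_double_root : v M.*2 = 0 /\ v M.*2.+1 = 1.
Proof.
have [-> ->] := chebV_double R M; rewrite hornerM (eqP yr) mul0r; split=> //.
by rewrite hornerD hornerN !horner_exp (eqP yr) expr0n subr0 chebV_after_root_sqr.
Qed.

(** From [V M.*2 = 0] and [V M.*2.+1 = 1] at [y], the recurrence run in both directions gives the
    values needed. The four zeros of [A], at [m.-1] to [m.+2], remove the boundary terms when
    [shiftL_sum] is applied twice. *)
Lemma A_seq_top i : (i < 4)%N -> (2 <= M)%N -> A (m.-1 + i) = 0.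
Proof.
case: m yr chebV_double_root => [//|m'] yr' [d1 d2] i4 _ /=.
rewrite !doubleS in d1 d2; set n := m'.*2 in d1 d2.
have E k : v k.+2 = 2 * y * v k.+1 - v k by exact: hchebVSS.
have e6 : v n.+4.+2 = 2 * y by rewrite E d1 d2; ring.
have e7 : v n.+4.+3 = 4 * y ^+ 2 - 1 by rewrite E e6 d2; ring.
have e3 : v n.+3 = -1 by have := E n.+3; rewrite d1 d2; lra.
have e2 : v n.+2 = - (2 * y) by have := E n.+2; rewrite d1 e3; lra.
have e1 : v n.+1 = 1 - 4 * y ^+ 2 by have := E n.+1; rewrite e3 e2; lra.
have e0 : v n = 4 * y - 8 * y ^+ 3 by have := E n; rewrite e1 e2; lra.
case: i i4 => [|[|[|[|//]]]] _; rewrite /A_seq ?addn0 ?addn1 ?addn2 ?addn3 ?doubleS -/n.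
- by rewrite e0 e1 -!natr1; field; rewrite y0 y1 !natr1 pnatr_eq0.
- by rewrite e2 e3 -!natr1; field; rewrite y0 y1 !natr1 pnatr_eq0.
- by rewrite d1 d2 -!natr1; field; rewrite y0 y1 !natr1 pnatr_eq0.
- by rewrite e6 e7 -!natr1; field; rewrite y0 y1 !natr1 pnatr_eq0.
Qed.

Definition A_poly : {poly R} := \sum_(k < m.-1) A k *: V k.*2.+1.

Lemma A_polyE : (0 < m)%N ->
  ('X^2 - (y ^+ 2)%:P) ^+ 2 * A_poly = (al * y ^+ 2 * (1 - y ^+ 2)) *: (1 * V M ^+ 2).
Proof.
move=> m0; have m2 : (2 <= M)%N by [].
have top1 := A_seq_top (isT : (1 < 4)%N) m2; have top2 := A_seq_top (isT : (2 < 4)%N) m2.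
have top0 := A_seq_top (isT : (0 < 4)%N) m2; have top3 := A_seq_top (isT : (3 < 4)%N) m2.
rewrite addn0 in top0; rewrite addn1 prednK// in top1.
rewrite addn2 prednK// in top2; rewrite addn3 prednK// in top3.
have QE : A_poly = \sum_(k < m.+1) A k *: V k.*2.+1.
  rewrite big_ord_recr /= top1 scale0r addr0.
  have H n (F : nat -> {poly R}) : \sum_(k < n.+1) F k = \sum_(k < n) F k + F n.
    by rewrite big_ord_recr.
  have := H m.-1 (fun k => A k *: V k.*2.+1).
  by rewrite prednK// top0 scale0r addr0 => ->.
have S1 := shiftL_sum y A m; rewrite top1 top2 !scale0r addr0 subr0 -QE in S1.
have S2 := shiftL_sum y (shiftL y A) m; rewrite -S1 in S2.
have b1 : shiftL y A m = 0.
  by rewrite -(prednK m0) /= prednK// top2 top0 top1 mulr0 subr0 addr0.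
have b2 : shiftL y A m.+1 = 0 by rewrite /= top3 top1 top2 mulr0 subr0 addr0.
rewrite b1 b2 !scale0r addr0 subr0 in S2.
(* The 16 comes from the factor 4 in each use of [shiftL_sum]; the sequence is now constant, and
   [sum_chebV_odd] sums it to a multiple of [V M ^+ 2]. *)
have {}S2 : (('X^2 - (y ^+ 2)%:P) ^+ 2 * A_poly) *+ 16 = (16 * al * y ^+ 2 * (1 - y ^+ 2)) *: V M ^+ 2.
  rewrite -sum_chebV_odd scaler_sumr.
  under [RHS]eq_bigr => k _ do rewrite -(A_seq_shift2 k).
  by rewrite -S2; ring.
have n16 : 16 != 0 :> R by rewrite pnatr_eq0.
by apply: (scalerI n16); rewrite scaler_nat S2 scalerA mul1r; congr (_ *: _); ring.
Qed.

Lemma ucoef_A_poly_even k : (k <= m.-1)%N -> (0 < m)%N -> ucoef k.*2 A_poly = A k.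
Proof.
move=> km m0; rewrite raddf_sum /=.
under eq_bigr => j _ do rewrite ucoefZ ucoef_chebV (inj_eq double_inj).
(* The index [m.-1] is outside the sum, but [A] vanishes there. *)
move: km; rewrite leq_eqVlt => /predU1P[->|km].
  have := A_seq_top (isT : (0 < 4)%N) (m0 : (1 < M)%N).
  rewrite addn0 => ->; rewrite big1// => j _.
  by rewrite gtn_eqF ?mulr0.
rewrite (bigD1 (Ordinal km))//= eqxx mulr1 big1 ?addr0// => j jk.
by rewrite -(inj_eq val_inj) /= eq_sym in jk; rewrite (negbTE jk) mulr0.
Qed.

Lemma ucoef_A_poly_odd k : ucoef k.*2.+1 A_poly = 0.
Proof.
rewrite raddf_sum /= big1// => j _; rewrite ucoefZ ucoef_chebV.
by case: eqP => [/(congr1 odd)|]; rewrite ?mulr0//= !odd_double.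
Qed.

Lemma Aseq0 : A 0 = 1.
Proof.
rewrite /A_seq -[V 1]/(1 : {poly R}) -[V 0]/(0 : {poly R}) hornerC horner0.
by field; rewrite y0 y1 nat1r pnatr_eq0.
Qed.

(* As [sin ((M - j) t) = +- sin (j t)] when [sin (M t) = 0]. *)
Lemma chebV_reflect_root j : (j <= M)%N -> v (M - j) = v m * v j.
Proof.
move=> jM; suff : v (M - j) = v m * v j /\ ((0 < j)%N -> v (M - j.-1) = v m * v j.-1) by case.
elim: j jM => [|[|j] IH] jM.
- by rewrite subn0 (eqP yr) horner0 mulr0.
- by rewrite subn1 subn0 (eqP yr) -[V 1]/(1 : {poly R}) hornerC mulr1 horner0 mulr0.
have [IH1 /(_ isT) IH2] := IH (ltnW jM); split=> //.
have e : (M - j = (M - j.+2).+2)%N by lia.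
have e' : (M - j.+1 = (M - j.+2).+1)%N by lia.
move: IH2 IH1; rewrite /= e e' hchebVSS [v j.+2]hchebVSS => h1 h2.
rewrite h2 in h1; lra.
Qed.

(** The right side is the coefficient of [U_(2k+1)] in [A_poly * X]; the left side is the closed
    form [A_even] up to the sign [v m], which the symmetric range of the parameter absorbs. *)
Lemma A_seq_add k : (k < m)%N ->
  v m * (2 * al * y * (1 - y ^+ 2) * v k.+1 * (V (m - k))^`().[y]) = (A k + A k.+1) / 2.
Proof.
move=> km.
have mk : (m - k = M - k.+1)%N by lia.
have mk' : ((m - k).+1 = M - k)%N by lia.
have d : (1 - y ^+ 2) * (V (m - k))^`().[y] = v m * ((M%:R - k%:R) * y * v k.+1 - (M%:R - 1 - k%:R) * v k).
  rewrite hchebV_deriv.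
  have v1 : v (m - k) = v m * v k.+1 by rewrite mk chebV_reflect_root// ltnS ltnW.
  have v2 : v (m - k).+1 = v m * v k by rewrite mk' chebV_reflect_root// (leqW (ltnW km)).
  have n1 : (m - k).+1%:R = M%:R - k%:R :> R by rewrite -natr1 (natrB _ (ltnW km)) -[M%:R]natr1; ring.
  have n2 : (m - k)%:R = M%:R - 1 - k%:R :> R by rewrite (natrB _ (ltnW km)) -[M%:R]natr1; ring.
  by rewrite v1 v2 n1 n2; ring.
have -> : v m * (2 * al * y * (1 - y ^+ 2) * v k.+1 * (V (m - k))^`().[y]) =
   2 * al * y * v k.+1 * (v m * ((1 - y ^+ 2) * (V (m - k))^`().[y])) by ring.
rewrite d mulrA -expr2 chebV_before_root_sqr mul1r /A_seq doubleS !hchebVSS.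
have [-> ->] := chebV_double R k.
have := chebV_pell k y; rewrite !(hornerM, hornerD, hornerN, horner_exp, hornerMn, hornerX).
move: (v k) (v k.+1) => b a pell.
(* The two sides differ by this multiple of the Pell relation, added as a zero so that [field] can
   conclude. *)
have := congr1 (fun one => al * y ^+ 2 / (1 - y ^+ 2) * (1 - one)) pell.
rewrite subrr mulr0 => F; rewrite -[LHS]addr0 -F -!natr1 ; field.
by rewrite y0 y1 !natr1 pnatr_eq0.
Qed.

End Fixed.
End InteriorNodes.

(** * The coefficients zeta_k *)

Section EndpointNodes.
Variable R : realType.
Local Notation V := (chebV R).

(** Abel summation with [sin ((2k+1) t) - sin ((2k-1) t) = 2 sin t cos (2 k t)]. *)
Lemma sum_by_parts_sin (c : nat -> R) n t :
  \sum_(k < n) (c k - c k.+1) * sin (k.*2.+1%:R * t) =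
  sin t * (c 0%N + 2 * \sum_(1 <= k < n.+1) c k * cos (k.*2%:R * t)) -
  c n * sin (n.*2.+1%:R * t).
Proof.
elim: n => [|n IH]; first by rewrite big_ord0 big_nil mul1r; ring.
rewrite [in RHS]big_nat_recr //= big_ord_recr /= IH.
have -> : n.+1.*2.+1%:R * t = n.+1.*2%:R * t + t by rewrite -natr1; ring.
have -> : n.*2.+1%:R * t = n.+1.*2%:R * t - t by rewrite doubleS -[in RHS]natr1; ring.
rewrite sinB sinD; ring.
Qed.

Lemma corr_recr (z : nat -> R) n d :
  corr z n.+1 d = corr z n d + z n.+1 * z (n.+1 + d)%N.
Proof. by rewrite /corr big_nat_recr. Qed.

Lemma corr0n (z : nat -> R) d : corr z 0 d = 0.
Proof. by rewrite /corr big_nil. Qed.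

(** Both sides are [|sum_j z_j e^(2ijt)|^2]; [corr z (n - k) k] collects the products with index
    difference [k]. *)
Lemma autocorr_square (z : nat -> R) n t :
  corr z n 0 + 2 * \sum_(1 <= k < n.+1) corr z (n - k) k * cos (k.*2%:R * t) =
  (\sum_(1 <= j < n.+1) z j * cos (j.*2%:R * t)) ^+ 2 +
  (\sum_(1 <= j < n.+1) z j * sin (j.*2%:R * t)) ^+ 2.
Proof.
elim: n => [|n IH]; first by rewrite corr0n !big_nil; ring.
have -> : \sum_(1 <= k < n.+2) corr z (n.+1 - k) k * cos (k.*2%:R * t) =
    \sum_(1 <= k < n.+1) corr z (n - k) k * cos (k.*2%:R * t) +
    \sum_(1 <= k < n.+1) z (n.+1 - k)%N * z n.+1 * cos (k.*2%:R * t).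
  rewrite big_nat_recr //= subnn corr0n mul0r addr0 -big_split /=.
  apply: eq_big_nat => k /andP[k1 kn].
  have kn' : (k <= n)%N by [].
  by rewrite (subSn kn') corr_recr addSn (subnK kn') mulrDl.
have -> : \sum_(1 <= k < n.+1) z (n.+1 - k)%N * z n.+1 * cos (k.*2%:R * t) =
   z n.+1 * (cos (n.+1.*2%:R * t) * (\sum_(1 <= j < n.+1) z j * cos (j.*2%:R * t)) +
   sin (n.+1.*2%:R * t) * (\sum_(1 <= j < n.+1) z j * sin (j.*2%:R * t))).
  rewrite big_nat_rev /= 2!mulr_sumr -big_split mulr_sumr /=.
  apply: eq_big_nat => k /andP[k1 kn]; rewrite add1n.
  have -> : (n.+1 - (n.+2 - k.+1) = k)%N by lia.
  have -> : (n.+2 - k.+1).*2%:R * t = n.+1.*2%:R * t - k.*2%:R * t.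
    by rewrite subSS doubleB natrB ?leq_double ?(ltnW kn)//; ring.
  rewrite cosB; ring.
rewrite corr_recr addn0 [in RHS]big_nat_recr //= [X in _ = _ + X ^+ 2]big_nat_recr //=.
set A := \sum_(1 <= j < n.+1) z j * cos _ in IH *.
set B := \sum_(1 <= j < n.+1) z j * sin _ in IH *.
set D := \sum_(1 <= j < n.+1) _ in IH *.
have -> : corr z n 0 + z n.+1 * z n.+1 + 2 * (D + z n.+1 * (cos (n.+1.*2%:R * t) * A + sin (n.+1.*2%:R * t) * B)) =
  (corr z n 0 + 2 * D) + z n.+1 ^+ 2 + 2 * (z n.+1 * (cos (n.+1.*2%:R * t) * A + sin (n.+1.*2%:R * t) * B)) by ring.
have cs := cos2Dsin2 (n.+1.*2%:R * t).
transitivity (A ^+ 2 + B ^+ 2 + z n.+1 ^+ 2 * (cos (n.+1.*2%:R * t) ^+ 2 + sin (n.+1.*2%:R * t) ^+ 2) +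
  2 * (z n.+1 * (cos (n.+1.*2%:R * t) * A + sin (n.+1.*2%:R * t) * B))).
  by rewrite cs mulr1 IH.
ring.
Qed.

(** The derivative in [t] of [U_m(cos t) = sum_j cos ((2j - m) t)], [0 <= j <= m], up to sign. *)
Lemma deriv_chebV_sin m t :
  \sum_(0 <= j < m.+1) (j.*2%:R - m%:R) * sin ((j.*2%:R - m%:R) * t) =
  sin t * ((V m.+1)^`()).[cos t].
Proof.
suff : forall m, \sum_(0 <= j < m.+1) (j.*2%:R - m%:R) * sin ((j.*2%:R - m%:R) * t) =
   sin t * ((V m.+1)^`()).[cos t] /\
  \sum_(0 <= j < m.+2) (j.*2%:R - m.+1%:R) * sin ((j.*2%:R - m.+1%:R) * t) =
   sin t * ((V m.+2)^`()).[cos t] by case/(_ m).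
elim=> {m} [|m [IH1 IH2]].
  rewrite deriv_chebV_diff -[V 1]/(1%:P) -[V 0]/(0%:P) !derivC.
  rewrite big_nat1 big_nat_recr //= big_nat1 double0 subrr !mul0r hornerC mulr0.
  split=> //; have -> : 0 + 1 *+ 2 * 1%:P = 2%:P :> {poly R} by rewrite polyC_natr polyC1; ring.
  rewrite hornerC -[1.*2]/2%N sub0r !mulN1r.
  have -> : 2 - 1 = 1 :> R by ring.
  by rewrite ?mulNr sinN !mul1r; ring.
split=> //; rewrite deriv_chebV_diff hornerD mulrDr -IH1 big_nat_recl// big_nat_recr//=.
have -> : \sum_(0 <= i < m.+1) (i.+1.*2%:R - m.+2%:R) * sin ((i.+1.*2%:R - m.+2%:R) * t) =
  \sum_(0 <= i < m.+1) (i.*2%:R - m%:R) * sin ((i.*2%:R - m%:R) * t).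
  apply: eq_bigr => i _; have -> // : i.+1.*2%:R - m.+2%:R = i.*2%:R - m%:R :> R.
  by rewrite doubleS -!natr1; ring.
have -> : sin t * ((m.+2%:R *+ 2 * V m.+2).[cos t]) = (m.+2%:R *+ 2) * sin (m.+2%:R * t).
  rewrite -polyC_natr -polyCMn hornerM hornerC -chebV_cos; ring.
have -> : m.+2.*2%:R - m.+2%:R = m.+2%:R :> R by rewrite -addnn natrD addrK.
by rewrite double0 sub0r !mulNr sinN; ring.
Qed.

Section Fixed.
Variables (m : nat) (y : R).
Hypothesis m1 : (1 < m)%N.
Hypothesis y0 : y != 0.
Hypothesis y1 : 0 < 1 - y ^+ 2.
Hypothesis yr : root (V m.+1)^`() y.
Local Notation v k := ((V k).[y]).

(* [zeta_k], extended by [0] to [k = 0] and [k = m]. *)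
Definition zeta_seq (k : nat) : R :=
  v k * v k.+1 - v (m - k) * v (m - k).+1 + (1 - 2 * k%:R / m%:R) * v m * v m.+1.

Local Notation kap := (4 * (1 - y ^+ 2) * v m * v m.+1).

Let m0 : m%:R != 0 :> R. Proof. by rewrite pnatr_eq0 -lt0n ltnW. Qed.

Lemma critical_rel : m.+1%:R * v m = m%:R * y * v m.+1.
Proof.
have := hchebV_deriv m.+1 y; rewrite (eqP yr) mulr0 hchebVSS -!natr1; lra.
Qed.

Lemma zeta_seq_anti k : (k <= m)%N -> zeta_seq (m - k) = - zeta_seq k.
Proof. by move=> km; rewrite /zeta_seq subKn// natrB//; field. Qed.

Lemma zeta_seq0 : zeta_seq 0 = 0.
Proof. by rewrite /zeta_seq subn0 /= horner0; field. Qed.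

Lemma zeta_seqm : zeta_seq m = 0.
Proof. by rewrite -[in LHS](subn0 m) zeta_seq_anti// zeta_seq0 oppr0. Qed.

Lemma prod_chebV_rec k : v k * v k.+1 + v k.+2 * v k.+3 - (4 * y ^+ 2 - 2) * (v k.+1 * v k.+2) = 2 * y.
Proof.
transitivity (2 * y * (v k.+1 ^+ 2 - 2 * y * v k.+1 * v k + v k ^+ 2)).
  by rewrite !hchebVSS; ring.
by rewrite chebV_pell mulr1.
Qed.

(** The products [v k * v k.+1] and their reflections under [k -> m - k] satisfy the same recurrence
    with the same constant [2 y], which cancels in the difference. Only the linear term of
    [zeta_seq] contributes. *)
Lemma zeta_seq_rec k : (k.+2 <= m)%N ->
  zeta_seq k.+2 + zeta_seq k - (4 * y ^+ 2 - 2) * zeta_seq k.+1 = kap * (1 - 2 * k.+1%:R / m%:R).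
Proof.
move=> km; have := prod_chebV_rec k; have := prod_chebV_rec (m - k.+2).
have e1 : ((m - k.+2).+1 = m - k.+1)%N by lia.
have e2 : ((m - k.+2).+2 = m - k)%N by lia.
rewrite /zeta_seq -e2 -e1 -[k.+2%:R]natr1 -[k.+1%:R]natr1.
pose kap0 := 4 * (1 - y ^+ 2); rewrite -/kap0.
move: (v k * v k.+1) (v k.+1 * v k.+2) (v k.+2 * v k.+3) (v m) (v m.+1) => a b c d e.
move: (v (m - k.+2)) (v (m - k.+2).+1) (v (m - k.+2).+2) (v (m - k.+2).+3) => f g h i E1 E2.
transitivity (kap0 * d * e * (1 - 2 * (k%:R + 1) / m%:R) +
  ((a + c - (4 * y ^+ 2 - 2) * b) - (f * g + h * i - (4 * y ^+ 2 - 2) * (g * h)))).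
  by rewrite /kap0; field.
by rewrite E1 E2 subrr addr0.
Qed.

(** Here [U_m'(y) = 0] enters: it gives [zeta_seq] the boundary value for which the end terms in
    [zeta_sin_sum_mul] match those of [U_m']. *)
Lemma zeta_seq1 : zeta_seq 1 = kap.
Proof.
have [m' mE] : exists m', m = m'.+2 by exists m.-2; case: (m) m1 => [|[|]].
have p := chebV_pell m y; have c := critical_rel.
have -> : zeta_seq 1 = 2 * y - (2 * y * v m - v m.+1) * v m + (1 - 2 / m%:R) * v m * v m.+1.
  rewrite /zeta_seq mE /= subSS subn0 !hchebVSS -[V 1]/(1 : {poly R}) -[V 0]/(0 : {poly R}) hornerC horner0.
  by ring.
move: (v m) (v m.+1) c p => B A c p.
have F : 2 * A * (m%:R * y * A - m.+1%:R * B) / m%:R = 0 by rewrite c subrr mulr0 mul0r.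
transitivity (4 * (1 - y ^+ 2) * B * A + 2 * A * (m%:R * y * A - m.+1%:R * B) / m%:R +
  2 * y * (1 - (A ^+ 2 - 2 * y * A * B + B ^+ 2))).
  by rewrite -[m.+1%:R]natr1; field.
by rewrite F p subrr mulr0 !addr0.
Qed.

(** By [critical_rel] both values would vanish together, against [chebV_pell]. *)
Lemma chebV_critical_neq0 : v m != 0 /\ v m.+1 != 0.
Proof.
have c := critical_rel; have p := chebV_pell m y.
have S0 : m.+1%:R != 0 :> R by rewrite pnatr_eq0.
suff h : v m != 0.
  split=> //; apply: contra_neq h => e; move: c; rewrite e mulr0 => /eqP.
  by rewrite mulf_eq0 (negbTE S0) => /eqP.
apply/eqP => e; move: c; rewrite e mulr0 => /esym/eqP.
rewrite mulf_eq0 mulf_eq0 (negbTE m0) (negbTE y0) /= => /eqP e'.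
by move: p; rewrite e e' expr0n /= !mulr0 subr0 addr0 => /esym/eqP; rewrite oner_eq0.
Qed.

Lemma zeta_seq1_neq0 : kap != 0.
Proof.
by have [? ?] := chebV_critical_neq0; rewrite !mulf_neq0// ?(lt0r_neq0 y1).
Qed.

Definition zeta_autocorr (k : nat) : R := corr zeta_seq (m.-1 - k) k.

Definition zeta_poly : {poly R} := \sum_(k < m.-1) (zeta_autocorr k - zeta_autocorr k.+1) *: V k.*2.+1.

Local Notation S t := (\sum_(1 <= j < m) zeta_seq j * sin ((j.*2%:R - m%:R) * t)).

(** Summation by parts gives [|sum_j zeta_j e^(2ijt)|^2]. After the factor [e^(-imt)] the
    antisymmetry [zeta_(m-j) = - zeta_j] kills the real part, leaving the square of the imaginary
    part. *)
Lemma zeta_poly_cos t : sin t != 0 -> zeta_poly.[cos t] = S t ^+ 2.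
Proof.
move=> st; apply: (mulfI st).
have mE : m = m.-1.+1 by rewrite prednK// ltnW.
pose Cz := \sum_(1 <= j < m) zeta_seq j * cos (j.*2%:R * t).
pose Sz := \sum_(1 <= j < m) zeta_seq j * sin (j.*2%:R * t).
have -> : sin t * zeta_poly.[cos t] = sin t * (Cz ^+ 2 + Sz ^+ 2).
  have AS : zeta_autocorr 0 + 2 * (\sum_(1 <= k < m.-1.+1) zeta_autocorr k * cos (k.*2%:R * t)) = Cz ^+ 2 + Sz ^+ 2.
    by rewrite /zeta_autocorr subn0 autocorr_square -mE.
  have ckm : zeta_autocorr m.-1 = 0 by rewrite /zeta_autocorr subnn corr0n.
  have := sum_by_parts_sin zeta_autocorr m.-1 t; rewrite AS ckm mul0r subr0 => <-.
  rewrite horner_sum mulr_sumr; apply: eq_bigr => k _.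
  by rewrite hornerZ -chebV_cos; ring.
congr (_ * _).
have SE : S t = Sz * cos (m%:R * t) - Cz * sin (m%:R * t).
  rewrite /Sz /Cz !mulr_suml -sumrB; apply: eq_bigr => j _.
  by rewrite mulrBl sinB; ring.
have CE : 0 = Cz * cos (m%:R * t) + Sz * sin (m%:R * t).
  have E : Cz * cos (m%:R * t) + Sz * sin (m%:R * t) = \sum_(1 <= j < m) zeta_seq j * cos ((j.*2%:R - m%:R) * t).
    rewrite /Sz /Cz !mulr_suml -big_split; apply: eq_bigr => j _ /=.
    by rewrite mulrBl cosB; ring.
  rewrite E; set F := \sum_(1 <= j < m) _.
  have : F = - F.
    rewrite {1}/F big_nat_rev /= -sumrN; apply: eq_big_nat => j /andP[j1 jm].
    rewrite add1n subSS zeta_seq_anti ?(ltnW jm)// mulNr; congr (- (_ * _)).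
    rewrite -cosN; congr cos; rewrite doubleB natrB ?leq_double ?(ltnW jm)//.
    by rewrite -(addnn m) natrD; ring.
  lra.
have -> : S t ^+ 2 = S t ^+ 2 + (Cz * cos (m%:R * t) + Sz * sin (m%:R * t)) ^+ 2.
  by rewrite -CE expr0n addr0.
rewrite SE.
have := cos2Dsin2 (m%:R * t); move: (cos _) (sin _) => c s cs.
by rewrite -[LHS]mulr1 -cs; ring.
Qed.

(** Multiplication by [4 cos^2 t] is a second-order difference on the sines ([wrec]). Moving it onto
    the coefficients ([gen]) and applying [zeta_seq_rec] leaves multiples of [2 j - m], the
    coefficients of [sin t * U_m'(cos t)]. *)
Lemma zeta_sin_sum_mul t : 4 * (cos t ^+ 2 - y ^+ 2) * S t = - (kap / m%:R) * (sin t * ((V m.+1)^`()).[cos t]).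
Proof.
pose w j := sin ((j.*2%:R - m%:R) * t).
have wrec j : 4 * cos t ^+ 2 * w j.+1 = w j.+2 + 2 * w j.+1 + w j.
  rewrite /w !doubleS; set x := (j.*2.+2%:R - m%:R) * t.
  have -> : (j.*2.+2.+2%:R - m%:R) * t = x + t *+ 2 by rewrite /x -!natr1; ring.
  have -> : (j.*2%:R - m%:R) * t = x - t *+ 2 by rewrite /x -!natr1; ring.
  rewrite sinD sinB sin_mulr2n cos_mulr2n; ring.
have gen (a : nat -> R) n : a 0%N = 0 ->
  4 * (cos t ^+ 2 - y ^+ 2) * (\sum_(1 <= j < n.+2) a j * w j) =
  a 1%N * w 0%N + \sum_(1 <= j < n.+2) (a j.+1 + a j.-1 - (4 * y ^+ 2 - 2) * a j) * w j
   + a n.+1 * w n.+2 - a n.+2 * w n.+1.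
  move=> a0; elim: n => [|n IH].
    have := wrec 0%N; rewrite !big_nat1 /= a0; move: (w _) (w _) (w _) => A B D E.
    have -> : 4 * (cos t ^+ 2 - y ^+ 2) * (a 1%N * D) = a 1%N * (4 * cos t ^+ 2 * D) - 4 * y ^+ 2 * a 1%N * D by ring.
    by rewrite E; ring.
  rewrite big_nat_recr //= mulrDr IH [in RHS]big_nat_recr //=.
  have -> : 4 * (cos t ^+ 2 - y ^+ 2) * (a n.+2 * w n.+2) = a n.+2 * (4 * cos t ^+ 2 * w n.+2) - 4 * y ^+ 2 * a n.+2 * w n.+2 by ring.
  by rewrite wrec; ring.
have mE : m = m.-2.+2 by case: (m) m1 => [|[|]].
have {gen} := gen zeta_seq m.-2 zeta_seq0; rewrite -mE zeta_seqm mul0r subr0 => ->.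
have -> : m.-2.+1 = m.-1 by case: (m) m1 => [|[|]].
rewrite -deriv_chebV_sin big_nat_recr //= [in RHS]big_ltn ?(ltnW m1)//.
rewrite zeta_seq1 !mulrDr mulr_sumr; congr (_ + _ + _).
- by rewrite /w double0 sub0r; field.
- apply: eq_big_nat => -[//|j] /andP[_ jm] /=.
  by rewrite zeta_seq_rec// /w doubleS -!natr1 -addnn natrD; field.
- have -> : zeta_seq m.-1 = - zeta_seq 1 by rewrite -subn1 zeta_seq_anti// ltnW.
  by rewrite zeta_seq1 /w -addnn natrD; field.
Qed.

(* [Q = S ^ 2] where [4 (x^2 - y^2) S] is a multiple of [sin t * U_m' (cos t)]. *)
Lemma zeta_polyE : ('X^2 - (y ^+ 2)%:P) ^+ 2 * zeta_poly =
  (kap / (4 * m%:R)) ^+ 2 *: ((1 - 'X^2) * (V m.+1)^`() ^+ 2).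
Proof.
apply: cos_inj_poly => t st; have := congr1 (fun x => x ^+ 2) (zeta_sin_sum_mul t).
rewrite (hornerM (_ ^+ 2)) zeta_poly_cos// hornerZ (hornerM (1 - 'X^2)).
rewrite !horner_exp !hornerD !hornerN !horner_exp !hornerC hornerX.
have -> : 1 - cos t ^+ 2 = sin t ^+ 2 by rewrite -[X in X - _](cos2Dsin2 t) addrAC subrr add0r.
set a := S t; set D := (_^`()).[_] => h.
have -> : (cos t ^+ 2 - y ^+ 2) ^+ 2 * a ^+ 2 = (4 * (cos t ^+ 2 - y ^+ 2) * a) ^+ 2 / 16 by field.
by rewrite h; field.
Qed.

Lemma zeta_poly_const_gt0 : 0 < (kap / (4 * m%:R)) ^+ 2.
Proof.
by rewrite lt0r sqr_ge0 andbT expf_neq0// mulf_neq0 ?zeta_seq1_neq0// invr_neq0// mulf_neq0// pnatr_eq0.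
Qed.

Lemma ucoef_zeta_poly_even k : (k <= m.-1)%N -> ucoef k.*2 zeta_poly = zeta_autocorr k - zeta_autocorr k.+1.
Proof.
move=> km; rewrite raddf_sum /=.
under eq_bigr => j _ do rewrite ucoefZ ucoef_chebV (inj_eq double_inj).
(* The index [m.-1] is outside the sum; both autocorrelations are then empty sums. *)
move: km; rewrite leq_eqVlt => /predU1P[->|km].
  rewrite /zeta_autocorr subnS subnn !corr0n subrr.
  by rewrite big1// => j _; rewrite gtn_eqF ?mulr0.
rewrite (bigD1 (Ordinal km))//= eqxx mulr1 big1 ?addr0// => j jk.
by rewrite -(inj_eq val_inj) /= eq_sym in jk; rewrite (negbTE jk) mulr0.
Qed.

Lemma ucoef_zeta_poly_odd k : ucoef k.*2.+1 zeta_poly = 0.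
Proof.
rewrite raddf_sum /= big1// => j _; rewrite ucoefZ ucoef_chebV.
by case: eqP => [/(congr1 odd)|]; rewrite ?mulr0//= !odd_double.
Qed.

End Fixed.
End EndpointNodes.

(** * Location of the nodes *)

Section Roots.
Variable R : realType.
Local Notation V := (chebV R).

Lemma root_chebVN n (x : R) : root (V n) (- x) = root (V n) x.
Proof. by rewrite /root chebVN mulf_eq0 signr_eq0. Qed.

Lemma chebV_odd_at0 n : (V n.*2.+1).[0] ^+ 2 = 1 :> R.
Proof.
elim: n => [|n IH]; first by rewrite -[V 1]/(1%:P) hornerC expr1n.
by rewrite doubleS hchebVSS mulr0 mul0r sub0r sqrrN.
Qed.

Lemma chebV_at0_neq0 n : odd n -> (V n).[0] != 0.
Proof.
move=> on; rewrite -(odd_double_half n) on add1n.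
by rewrite -sqrf_eq0 chebV_odd_at0 oner_eq0.
Qed.

Lemma deriv_chebVN n (x : R) : x ^+ 2 != 1 ->
  root (V n)^`() x -> root (V n)^`() (- x).
Proof.
move=> x1 /eqP rx; have nz : 1 - x ^+ 2 != 0 by rewrite subr_eq0 eq_sym.
apply/eqP/(mulfI nz); rewrite mulr0 -(sqrrN x) hchebV_deriv !chebVN.
have := hchebV_deriv n x; rewrite rx mulr0 => /esym h.
rewrite -[RHS](mulr0 ((-1) ^+ n)) -h !exprS; ring.
Qed.

Lemma deriv_chebV_at0 n : ~~ odd n -> n != 0%N -> ((V n)^`()).[0] != 0.
Proof.
move=> en n0; have := hchebV_deriv n (0 : R).
rewrite expr0n subr0 mul1r mulr0 mul0r sub0r => ->.
by rewrite oppr_eq0 mulf_neq0 ?pnatr_eq0 ?chebV_at0_neq0.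
Qed.

Lemma min_pos_mem (s : seq R) (x : R) : x \in s -> 0 < x ->
  exists y, [/\ y \in s, 0 < y & forall x, x \in s -> 0 < x -> y <= x].
Proof.
elim: s x => [//|a s IH] x xas x0.
have [[z zs z0]|no] := pselect (exists2 x, x \in s & 0 < x).
  have [y [ys y0 ym]] := IH z zs z0.
  have [a0|a0] := ltP 0 a; last first.
    exists y; split=> //; first by rewrite inE ys orbT.
    by move=> u; rewrite inE => /predU1P[->|us u0]; [rewrite ltNge a0|exact: ym].
  have [ay|ya] := leP a y.
    exists a; split=> //; first by rewrite inE eqxx.
    move=> u; rewrite inE => /predU1P[->//|us u0].
    exact: le_trans ay (ym _ us u0).
  exists y; split=> //; first by rewrite inE ys orbT.
  by move=> u; rewrite inE => /predU1P[->|us u0]; [rewrite ltW|exact: ym].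
have ns u : u \in s -> ~~ (0 < u) by move=> us; apply/negP => u0; apply: no; exists u.
have ax : a = x.
  by move: xas; rewrite inE => /predU1P[->//|/ns]; rewrite x0.
exists a; split; rewrite ?inE ?eqxx ?ax//.
by move=> u; rewrite inE => /predU1P[->//|/ns/negbTE->].
Qed.

Lemma max_root_chebV m : (2 < m)%N ->
  let y : R := cos (pi / m.+1%:R) in
  [/\ is_max_root (V m.+1) y, 0 < y, 0 < 1 - y ^+ 2 &
      forall x, root (V m.+1) x -> 0 <= y ^+ 2 - x ^+ 2].
Proof.
move=> m2 y; have m0 : (0 < m)%N by case: (m) m2.
have yE : y = cos (1%:R * pi / m.+1%:R) by rewrite mul1r.
have yin : y \in gauss_nodes R m by apply/mapP; exists 0%N; rewrite ?mem_iota.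
have [t0 t1] := cos_nodeP R m0.
have ymax x : root (V m.+1) x -> x <= y.
  rewrite mem_gauss_nodes; case/mapP => i; rewrite mem_iota => /andP[_ im] ->.
  have [i0 i1] := cos_nodeP R im.
  have It k (h : (k < m)%N) : k.+1%:R * pi / m.+1%:R \in `[0, pi : R].
    by have [? ?] := cos_nodeP R h; rewrite in_itv /= !ltW.
  rewrite yE leNgt ltr_cos ?It// -leNgt.
  by rewrite ler_pM2r ?invr_gt0 ?ltr0n// ler_pM2r ?pi_gt0// ler_nat.
have /andP[yl yr] := gauss_nodes_itv yin.
have y0 : 0 < y.
  apply: cos_gt0_pihalf; rewrite (@lt_trans _ _ 0) ?oppr_lt0 ?divr_gt0 ?pi_gt0 ?ltr0n//=.
  by rewrite ltr_pM2l ?pi_gt0// ltf_pV2 ?posrE ?ltr0n// ltr_nat ltnS ltnW.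
split=> //.
- by split=> //; rewrite mem_gauss_nodes.
- by rewrite subr_gt0; nra.
move=> x xr; have h1 := ymax _ xr; have h2 : - x <= y by apply: ymax; rewrite root_chebVN.
nra.
Qed.

Lemma min_pos_root_chebV m : (2 < m)%N -> ~~ odd m ->
  let y : R := sin (pi / m.+1.*2%:R) in
  [/\ is_min_pos_root (V m.+1) y, 0 < 1 - y ^+ 2 &
      forall x, root (V m.+1) x -> 0 <= - (y ^+ 2 - x ^+ 2)].
Proof.
move=> m2 em y; have m0 : (0 < m)%N by case: (m) m2.
have mE : m = m./2.*2 by rewrite -[LHS]odd_double_half (negbTE em).
have h0 : (0 < m./2)%N by lia.
(* For even [m], [pi / 2 - pi / (2 (m + 1))] is [m / 2] times [pi / (m + 1)], so [y] is the last
   node to the right of 0. *)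
have yE : y = cos (m./2.-1.+1%:R * pi / m.+1%:R).
  rewrite prednK// /y -cosBpihalf -cosN; congr cos.
  have -> : m.+1.*2%:R = 2 * m.+1%:R :> R by rewrite -muln2 natrM mulrC.
  have -> : m.+1%:R = 2 * (m./2)%:R + 1 :> R by rewrite {1}mE -muln2 -natr1 natrM; ring.
  have : 2 * (m./2)%:R + 1 != 0 :> R by rewrite -(natrM _ 2) natr1 pnatr_eq0.
  by move=> nz; field; rewrite nz.
have yin : y \in gauss_nodes R m.
  by rewrite yE; apply/mapP; exists m./2.-1; rewrite ?mem_iota//; lia.
have /andP[yl yr] := gauss_nodes_itv yin.
have y0 : 0 < y.
  apply: sin_gt0_pi; rewrite divr_gt0 ?pi_gt0 ?ltr0n//= ltr_pdivrMr ?ltr0n//.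
  by rewrite ltr_pMr ?pi_gt0// ltr1n doubleS.
have ymin x : 0 < x -> root (V m.+1) x -> y <= x.
  move=> x0; rewrite mem_gauss_nodes; case/mapP => i; rewrite mem_iota => /andP[_ im] xE.
  have It k (h : (k < m)%N) : k.+1%:R * pi / m.+1%:R \in `[0, pi : R].
    by have [? ?] := cos_nodeP R h; rewrite in_itv /= !ltW.
  rewrite xE yE leNgt ltr_cos ?It//; last by lia.
  rewrite -leNgt ler_pM2r ?invr_gt0 ?ltr0n// ler_pM2r ?pi_gt0// ler_nat prednK//.
  have : 0 < cos (i.+1%:R * pi / m.+1%:R : R) by rewrite -xE.
  have Ih : pi / 2 \in `[0, pi : R] by rewrite in_itv /= divr_ge0 ?pi_ge0//= ler_pdivrMr// ler_pMr ?pi_gt0// ler1n.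
  rewrite -(cos_pihalf R) ltr_cos ?It// [_ * pi / _]mulrAC [pi / 2]mulrC ltr_pM2r ?pi_gt0//.
  rewrite ltr_pdivrMr ?ltr0n// mulrC ltr_pdivlMr// -natrM ltr_nat; lia.
split=> //.
- by split=> //; rewrite mem_gauss_nodes.
- by rewrite subr_gt0; nra.
move=> x xr; have [x0|x0|x0] := ltgtP x 0.
- have : y <= - x by apply: ymin; rewrite ?oppr_gt0 ?root_chebVN.
  nra.
- have := ymin _ x0 xr; nra.
- by move: xr; rewrite x0 /root (negbTE (chebV_at0_neq0 _)).
Qed.

(** The zeros are symmetric about 0, and for odd [m] the point 0 is not one of them, so there is a
    positive zero and the least one has the least modulus. *)
Lemma min_pos_root_deriv_chebV m : (2 < m)%N -> odd m -> exists y : R,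
  [/\ is_min_pos_root (V m.+1)^`() y, 0 < 1 - y ^+ 2 &
      forall x, -1 < x < 1 -> root (V m.+1)^`() x -> 0 <= - (y ^+ 2 - x ^+ 2)].
Proof.
move=> m2 om; have [s [us ss sI sr]] := deriv_chebV_roots R m.
have nz : (V m.+1)^`() != 0 by rewrite -size_poly_eq0 size_deriv_chebV; case: (m) m2.
have mem x : root (V m.+1)^`() x -> x \in s.
  move=> xr; apply/negPn/negP => xs.
  have := @max_poly_roots _ (V m.+1)^`() (x :: s) nz.
  rewrite /= xr xs us size_deriv_chebV ss /= prednK ?ltnn; last by case: (m) m2.
  by move=> H; suff // : false by []; apply: H => //; apply/allP => z /sr.
have sN x : x \in s -> - x \in s.
  move=> xs; apply: mem; apply: deriv_chebVN; last exact: sr.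
  by rewrite lt_eqF//; case/andP: (sI _ xs) => *; nra.
have s0 x : x \in s -> x != 0.
  move=> xs; apply/eqP => x0; have := sr _ xs; rewrite x0.
  by rewrite /root (negbTE (deriv_chebV_at0 _ _))//= negbK.
have [z zs z0] : exists2 z, z \in s & 0 < z.
  case: s us ss sI sr mem sN s0 => [|z s] us ss sI sr mem sN s0.
    by case: (m) m2 ss => [|[|[]]].
  have zs : z \in z :: s by rewrite inE eqxx.
  have [h|h|h] := ltgtP z 0; last by move: (s0 _ zs); rewrite h eqxx.
    by exists (- z); [exact: sN|rewrite oppr_gt0].
  by exists z.
have [y [ys y0 ymin]] := min_pos_mem zs z0.
have /andP[yl yr] := sI _ ys.
exists y; split.
- by split=> //; [exact: sr|move=> x x0 /mem/ymin; apply].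
- by rewrite subr_gt0; nra.
move=> x _ /mem xs; have [x0|x0|x0] := ltgtP x 0.
- have : y <= - x by apply: ymin; rewrite ?oppr_gt0 ?sN.
  nra.
- have := ymin _ xs x0; nra.
- by move: (s0 _ xs); rewrite x0 eqxx.
Qed.

End Roots.

(** * The extremal polynomials *)

Section Instances.
Variable R : realType.
Local Notation V := (chebV R).

Lemma ucoefMX_even (b : nat -> R) n (Q0 : {poly R}) (tau : R) :
  (forall k, (k <= n)%N -> ucoef k.*2 Q0 = b k) -> (forall k, ucoef k.*2.+1 Q0 = 0) ->
  (forall k, (k <= n)%N -> ucoef k.*2 (Q0 * (1 + tau *: 'X)) = b k) /\
  (forall k, (k < n)%N -> ucoef k.*2.+1 (Q0 * (1 + tau *: 'X)) = tau * ((b k + b k.+1) / 2)).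
Proof.
move=> he ho; split=> k kn; rewrite mulrDr mulr1 -scalerAr raddfD /= ucoefZ ucoefMX.
  rewrite (he _ kn) ho add0r.
  by case: k kn => [|k] kn; rewrite ?doubleS ?ho mul0r mulr0 addr0.
by rewrite ho add0r -doubleS (he _ kn) (he _ (ltnW kn)) addrC.
Qed.

Lemma chebV_eqp m : V m.+1 %= \prod_(x <- gauss_nodes R m) ('X - x%:P).
Proof.
rewrite chebV_factor eqp_scale//.
by rewrite lead_coef_eq0 -size_poly_eq0 size_chebV.
Qed.

Lemma extremal_data_A m (y sg : R) : (2 < m)%N -> root (V m.+1) y -> y != 0 ->
  0 < 1 - y ^+ 2 -> sg ^+ 2 = 1 ->
  (forall x, root (V m.+1) x -> 0 <= sg * (y ^+ 2 - x ^+ 2)) ->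
  extremal_data m sg y (A_poly m y).
Proof.
move=> m2 yr y0 y1 sg1 nodes; have m0 : (0 < m)%N by case: (m) m2.
have y1' := lt0r_neq0 y1.
apply: (@extremal_summary R m [::] (gauss_nodes R m) (weight (gauss_nodes R m)) 1 (V m.+1) (A_poly m y)
  (m.+1%:R^-1 * y ^+ 2 * (1 - y ^+ 2)) y sg) => //=.
- exact: gauss_nodes_uniq.
- exact: gauss_nodes_itv.
- by rewrite big_nil eqpxx.
- exact: chebV_eqp.
- by move=> x _; rewrite hornerC.
- by rewrite size_gauss_nodes.
- exact: gauss_weight_gt0.
- by move=> p hp; rewrite (@gauss_quadrature _ m)// addnn.
- have y2 : 0 < y ^+ 2 by rewrite lt0r sqr_ge0 sqrf_eq0 y0.
  by rewrite mulr_gt0// mulr_gt0// invr_gt0 ltr0n.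
- exact: A_polyE.
- by rewrite -[0%N]double0 ucoef_A_poly_even// Aseq0.
- by rewrite ucoefMX addr0 (ucoef_A_poly_odd m y 0) mul0r.
- by move=> x /gauss_nodes_root/nodes.
Qed.

(** This is the denominator in [coefs_zeta] and [family_zeta]: the integral of [zeta_poly], which is
    nonnegative and nonzero by [zeta_polyE]. *)
Lemma zeta_autocorr_diff_gt0 m (y : R) : (1 < m)%N -> root (V m.+1)^`() y -> y != 0 ->
  0 < 1 - y ^+ 2 -> 0 < zeta_autocorr m y 0 - zeta_autocorr m y 1.
Proof.
move=> m1 yr y0 y1; have E := zeta_polyE m1 y0 y1 yr.
have c0 := zeta_poly_const_gt0 m1 y0 y1 yr.
have <- : ucoef 0 (zeta_poly m y) = zeta_autocorr m y 0 - zeta_autocorr m y 1.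
  by rewrite -[0%N]double0 ucoef_zeta_poly_even.
have r0 : nonneg_on_itv ((4 * (1 - y ^+ 2) * (V m).[y] * (V m.+1).[y] / (4 * m%:R)) ^+ 2 *: ((1 - 'X^2) * (V m.+1)^`() ^+ 2)).
  move=> x xI; rewrite hornerZ pmulr_rge0// hornerM horner_exp mulr_ge0 ?sqr_ge0//.
  by rewrite hornerD hornerN hornerXn hornerC; nra.
have n0 : ('X^2 - (y ^+ 2)%:P) ^+ 2 != 0 :> {poly R} by exact: node_factor_neq0.
apply: ucoef0_gt0.
  apply: (nonneg_cancel n0); first by move=> x _; rewrite horner_exp sqr_ge0.
  by rewrite mulrC E.
apply: contra_eq_neq E => ->; rewrite mulr0 eq_sym scaler_eq0 negb_or (gt_eqF c0).
rewrite mulf_neq0 ?expf_neq0 -?size_poly_eq0 ?size_deriv_chebV -?lt0n ?(ltnW m1)//.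
by rewrite -opprB size_polyN size_XnsubC.
Qed.

Definition zeta_npoly m (y : R) : {poly R} := (zeta_autocorr m y 0 - zeta_autocorr m y 1)^-1 *: zeta_poly m y.

Lemma extremal_data_zeta m (y : R) : (2 < m)%N -> root (V m.+1)^`() y -> y != 0 ->
  0 < 1 - y ^+ 2 ->
  (forall x, -1 < x < 1 -> root (V m.+1)^`() x -> 0 <= - (y ^+ 2 - x ^+ 2)) ->
  extremal_data m (-1) y (zeta_npoly m y).
Proof.
move=> m2 yr y0 y1 nodes; have m1 : (1 < m)%N by exact: ltnW.
have m0 : (0 < m)%N by exact: ltnW.
have n0 := zeta_autocorr_diff_gt0 m1 yr y0 y1.
have [s [w [us ss sI sr [wpos quad]]]] := lobatto_quadrature R m0.
apply: (@extremal_summary R m [:: 1; -1] s w (1 - 'X^2) (V m.+1)^`() _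
  ((zeta_autocorr m y 0 - zeta_autocorr m y 1)^-1 * (4 * (1 - y ^+ 2) * (V m).[y] * (V m.+1).[y] / (4 * m%:R)) ^+ 2) y (-1)) => //=.
- by move=> x; rewrite !inE => /orP[]/eqP->; lra.
- rewrite !big_cons big_nil mulr1.
  have -> : 1 - 'X^2 = (-1) *: (('X - 1%:P) * ('X - (-1)%:P)) :> {poly R}.
    by rewrite scaleN1r polyCN; ring.
  by rewrite eqp_scale ?oppr_eq0 ?oner_eq0.
- rewrite {1}(@all_roots_prod_XsubC _ (V m.+1)^`() s).
  + by rewrite eqp_scale// lead_coef_eq0 -size_poly_eq0 size_deriv_chebV -lt0n.
  + by rewrite size_deriv_chebV ss prednK.
  + by apply/allP => x /sr.
  + by rewrite uniq_rootsE; case/and3P: us.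
- by move=> x xI; rewrite hornerD hornerN hornerXn hornerC; nra.
- by rewrite ss; lia.
- by move=> p hp; rewrite quad// addnn.
- by rewrite mulr_gt0 ?invr_gt0 ?zeta_poly_const_gt0.
- by rewrite /zeta_npoly -scalerAr zeta_polyE// scalerA.
- by rewrite ucoefZ -[X in ucoef X]double0 ucoef_zeta_poly_even// mulVf// lt0r_neq0.
- by rewrite -scalerAl ucoefZ ucoefMX addr0 (ucoef_zeta_poly_odd m y 0) mul0r mulr0.
- by rewrite sqrrN expr1n.
- move=> x; rewrite !inE mulN1r => /or3P[/eqP->|/eqP->|xs].
  + by rewrite expr1n opprB ltW.
  + by rewrite sqrrN expr1n opprB ltW.
  + exact: nodes (sI _ xs) (sr _ xs).
Qed.

Lemma ucoef_top (p : {poly R}) n : size p = n.+1 -> ucoef n p != 0.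
Proof.
move=> sp; apply/eqP => p0; have : (size p <= n)%N.
  rewrite (chebV_expansion (leqnn (size p))) sp big_ord_recr /= p0 scale0r addr0.
  apply: (big_ind (fun q : {poly R} => (size q <= n)%N)).
  - by rewrite size_poly0.
  - by move=> a b ha hb; rewrite (leq_trans (size_polyD _ _))// geq_max ha.
  - by move=> j _; rewrite (leq_trans (size_scale_leq _ _))// size_chebV.
by rewrite sp ltnn.
Qed.

End Instances.

(** * Transfer from [admissible] polynomials to [T] and [T_le], for either order [r] *)

Section Transfer.
Variables (R : realType) (r : R[i] -> R[i] -> bool) (rR : R -> R -> bool).
Variables (N : nat) (c : R) (X : {poly R} -> Prop).
Hypothesis rE : forall a b : R, r a%:C b%:C = rR a b.
Hypothesis rR_anti : forall a b, rR a b -> rR b a -> a = b.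
Hypothesis N0 : (0 < N)%N.
Hypothesis c_bound : forall Q : {poly R}, admissible N Q -> rR (ucoef 2 Q) c.
Hypothesis c_attained : forall Q : {poly R}, (admissible N Q /\ ucoef 2 Q = c) <-> X Q.
Hypothesis X_top : exists2 Q, X Q & ucoef N.-1 Q != 0.

Lemma tr_poly_T_le (Q : {poly R}) : admissible N Q -> T_le R N (tr_poly Q).
Proof. by case=> Q0 sQ Q1; apply/T_le_tr_polyP => //; exists Q. Qed.

Lemma tr_poly_T (Q : {poly R}) : admissible N Q -> ucoef N.-1 Q != 0 -> T R N (tr_poly Q).
Proof.
move=> Qa Qt; apply/T_T_leP; split; first exact: tr_poly_T_le.
rewrite -(prednK N0) coef_tr_polyS; apply: contra Qt => /eqP E.
by apply/eqP/complexI; rewrite E.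
Qed.

Lemma coef3_bound (P : {poly R[i]}) : T_le R N P -> r P`_3 c%:C.
Proof.
move=> /(T_le_tr_polyP _ N0)[Q [Q0 sQ Q1 ->]]; rewrite coef_tr_polyS rE.
exact: c_bound.
Qed.

Lemma extremal_T_le (P : {poly R[i]}) :
  (T_le R N P /\ forall P', T_le R N P' -> r P'`_3 P`_3) <->
  exists2 Q, X Q & P = tr_poly Q.
Proof.
split=> [[/(T_le_tr_polyP _ N0)[Q [Q0 sQ Q1 PE]] H]|[Q /c_attained[Qa Q2] ->]]; last first.
  split; first exact: tr_poly_T_le.
  by move=> P' /coef3_bound; rewrite coef_tr_polyS Q2.
exists Q => //; apply/c_attained; split; first by split.
have [Q' /c_attained[Q'a Q'2] _] := X_top.
have := H _ (tr_poly_T_le Q'a); rewrite PE !coef_tr_polyS rE Q'2 => h.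
by apply: rR_anti => //; apply: c_bound.
Qed.

Lemma extremal_T (P : {poly R[i]}) :
  (T R N P /\ forall P', T R N P' -> r P'`_3 P`_3) <->
  exists Q, [/\ X Q, ucoef N.-1 Q != 0 & P = tr_poly Q].
Proof.
split=> [[/T_T_leP[/(T_le_tr_polyP _ N0)[Q [Q0 sQ Q1 PE]] PN] H]|[Q [/c_attained[Qa Q2] Qt ->]]]; last first.
  split; first exact: tr_poly_T.
  by move=> P' /T_T_leP[/coef3_bound h _]; move: h; rewrite coef_tr_polyS Q2.
exists Q; split=> //; last first.
  move: PN; rewrite PE -(prednK N0) coef_tr_polyS; apply: contra => /eqP->.
  by rewrite eqxx.
apply/c_attained; split; first by split.
have [Q' /c_attained[Q'a Q'2] Q't] := X_top.
have := H _ (tr_poly_T Q'a Q't); rewrite PE !coef_tr_polyS rE Q'2 => h.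
by apply: rR_anti => //; apply: c_bound.
Qed.

(** [X_top] supplies an extremal polynomial of degree exactly [N], so the bound is attained in [T]
    and not only in [T_le]. *)
Lemma extremum_value : a3_values R N c%:C /\ forall v, a3_values R N v -> r v c%:C.
Proof.
split.
  have [Q /c_attained[Qa Q2] Qt] := X_top.
  by exists (tr_poly Q); [exact: tr_poly_T|rewrite coef_tr_polyS Q2].
by move=> _ [P /T_T_leP[/coef3_bound h _] <-].
Qed.

End Transfer.

(** * Odd and even degree, and the closed forms of the coefficients *)

Section Cases.
Variable R : realType.
Local Notation V := (chebV R).

Section Direction.
Variables (r : R[i] -> R[i] -> bool) (rR : R -> R -> bool) (m : nat) (sg y : R).
Variable Q0 : {poly R}.
Hypothesis rE : forall a b : R, r a%:C b%:C = rR a b.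
Hypothesis rR_anti : forall a b, rR a b -> rR b a -> a = b.
Hypothesis sg_rR : forall a b, sg * a <= sg * b -> rR a b.
Hypothesis m2 : (2 < m)%N.
Hypothesis data : extremal_data m sg y Q0.
Local Notation c := (4 * y ^+ 2 - 1).

Lemma odd_case N : N = (m.*2 - 3)%N ->
  (a3_values R N c%:C /\ forall v, a3_values R N v -> r v c%:C) /\
  (forall P, (T R N P /\ forall P', T R N P' -> r P'`_3 P`_3) <-> P = tr_poly Q0).
Proof.
move=> NE; have [le _ eq sQ0] := data.
have N0 : (0 < N)%N by lia.
have bound (Q : {poly R}) : admissible N Q -> rR (ucoef 2 Q) c.
  move=> [Qge0 sQ Q1]; apply/sg_rR/le; split=> //.
  by rewrite (leq_trans sQ)// NE leq_sub2l.
have att (Q : {poly R}) : (admissible N Q /\ ucoef 2 Q = c) <-> Q = Q0.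
  by rewrite NE; exact: eq.
have top : exists2 Q, Q = Q0 & ucoef N.-1 Q != 0.
  exists Q0 => //; apply: ucoef_top; rewrite (prednK N0) NE -sQ0.
  by rewrite addnK.
split; first exact: (extremum_value rE N0 bound att top).
move=> P; rewrite (extremal_T rE rR_anti N0 bound att top).
split=> [[Q [-> _ ->]]//|->]; exists Q0; split=> //.
by have [Q ->] := top.
Qed.

Lemma size_linear_factor (tau : R) : tau != 0 ->
  size (Q0 * (1 + tau *: 'X)) = (size Q0).+1.
Proof.
move=> t0; have s2 : size (1 + tau *: 'X)%R = 2.
  by rewrite addrC size_polyDl ?size_scale ?size_polyX// size_poly1.
have [_ _ _ sQ0] := data.
have nz : Q0 != 0.
  apply/eqP => e; move: sQ0; rewrite e size_poly0; lia.
by rewrite size_mul// -?size_poly_eq0 s2// addn2.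
Qed.

(** The parameter of [fam] may differ from that of [Q0 * (1 + tau X)] by a sign [d], as [-1, 1] is
    symmetric. The degree is exactly [N] when [tau != 0]. *)
Lemma even_case N (fam : R -> {poly R[i]} -> Prop) (d : R) : N = (m.*2 - 2)%N ->
  d ^+ 2 = 1 ->
  (forall tau, fam (d * tau) (tr_poly (Q0 * (1 + tau *: 'X)))) ->
  (forall tau P P', fam tau P -> fam tau P' -> P = P') ->
  (a3_values R N c%:C /\ forall v, a3_values R N v -> r v c%:C) /\
  extremal_family (fun S P => S P /\ forall P', S P' -> r P'`_3 P`_3) N fam.
Proof.
move=> NE d1 famQ fam_inj; have [le eq _ sQ0] := data.
have N0 : (0 < N)%N by lia.
have sQ0N : (size Q0).+1 = N.
  have arith (a n : nat) : (2 < n -> a + 3 = n.*2 -> a.+1 = n.*2 - 2)%N by lia.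
  by rewrite NE; exact: arith m2 sQ0.
pose X (Q : {poly R}) := exists2 tau : R, -1 <= tau <= 1 & Q = Q0 * (1 + tau *: 'X).
have bound (Q : {poly R}) : admissible N Q -> rR (ucoef 2 Q) c.
  by move=> Qa; apply/sg_rR/le; rewrite -NE.
have att (Q : {poly R}) : (admissible N Q /\ ucoef 2 Q = c) <-> X Q.
  by rewrite NE; exact: eq.
have topE (tau : R) : (ucoef N.-1 (Q0 * (1 + tau *: 'X)) != 0) = (tau != 0).
  have [->|t0] := eqVneq tau 0.
    by rewrite scale0r addr0 mulr1 ucoef_big ?eqxx// -sQ0N.
  by apply: ucoef_top; rewrite size_linear_factor// (prednK N0).
have top : exists2 Q, X Q & ucoef N.-1 Q != 0.
  exists (Q0 * (1 + 1 *: 'X)); last by rewrite topE oner_neq0.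
  by exists 1 => //; rewrite lexx andbT; lra.
have dd (tau : R) : d * (d * tau) = tau by rewrite mulrA -expr2 d1 mul1r.
have dI (tau : R) : -1 <= tau <= 1 -> -1 <= d * tau <= 1.
  move/eqP: d1; rewrite sqrf_eq1 => /orP[]/eqP->; rewrite ?mul1r ?mulN1r//.
  by move=> ?; lra.
have d0 (tau : R) : (d * tau != 0) = (tau != 0).
  by rewrite mulf_eq0 -sqrf_eq0 d1 oner_eq0.
split; first exact: (extremum_value rE N0 bound att top).
split=> P.
  rewrite (extremal_T rE rR_anti N0 bound att top); split.
    move=> [Q [[tau tI ->] Qt ->]]; exists (d * tau); split; [exact: dI| |exact: famQ].
    by rewrite d0 -topE.
  move=> [tau [tI t0 Pf]]; exists (Q0 * (1 + (d * tau) *: 'X)); split.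
  - by exists (d * tau) => //; exact: dI.
  - by rewrite topE d0.
  - by apply: fam_inj Pf _; rewrite -{1}(dd tau); exact: famQ.
rewrite (extremal_T_le rE rR_anti N0 bound att top); split.
  by move=> [Q [tau tI ->] ->]; exists (d * tau); split; [exact: dI|exact: famQ].
move=> [tau [tI Pf]]; exists (Q0 * (1 + (d * tau) *: 'X)).
  by exists (d * tau) => //; exact: dI.
by apply: fam_inj Pf _; rewrite -{1}(dd tau); exact: famQ.
Qed.

End Direction.

Lemma normalized_poly_eq N (P P' : {poly R[i]}) : ~~ odd N ->
  normalized_poly N P -> normalized_poly N P' ->
  (forall k, (k <= (N - 2)./2)%N -> P`_(2 * k + 1) = P'`_(2 * k + 1) /\
     P`_(2 * k + 2) = P'`_(2 * k + 2)) -> P = P'.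
Proof.
move=> eN [sP P0 P1] [sP' P'0 P'1] H; apply/polyP => -[|i]; first by rewrite P0.
have [iN|iN] := ltnP i N; last by rewrite !nth_default// (leq_trans sP, leq_trans sP').
have [oi|ei] := boolP (odd i).
  have -> : i.+1 = (2 * i./2 + 2)%N by lia.
  by apply: (H i./2 _).2; lia.
have -> : i.+1 = (2 * i./2 + 1)%N by lia.
by apply: (H i./2 _).1; lia.
Qed.

Lemma normalized_tr_poly N (Q : {poly R}) : (size Q <= N)%N -> ucoef 0 Q = 1 ->
  normalized_poly N (tr_poly Q).
Proof.
by move=> sQ Q1; split; rewrite ?coef_tr_poly0 ?coef_tr_polyS ?Q1//; exact: size_tr_poly.
Qed.

Lemma normalized_linear_factor N m (Q0 : {poly R}) (tau : R) :
  N = (m.*2 - 2)%N -> (size Q0 + 3 = m.*2)%N -> ucoef 0 (Q0 * (1 + tau *: 'X)) = 1 ->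
  normalized_poly N (tr_poly (Q0 * (1 + tau *: 'X))).
Proof.
move=> NE sQ0 Q1; apply: normalized_tr_poly => //.
rewrite (leq_trans (size_polyMleq _ _))//.
have s2 : (size (1 + tau *: 'X)%R <= 2)%N.
  rewrite (leq_trans (size_polyD _ _))// geq_max size_poly1 /=.
  by rewrite (leq_trans (size_scale_leq _ _))// size_polyX.
have arith (a b n : nat) : (a + 3 = n -> b <= 2 -> (a + b).-1 <= n - 2)%N by lia.
by rewrite NE; exact: arith sQ0 s2.
Qed.

Lemma A_oddE N k (y : R) m : alpha R N = m.+1%:R^-1 -> A_odd N k y = A_seq m.+1%:R^-1 y k.
Proof.
move=> aE; rewrite /A_odd /A_seq aE /= mul2n.
have -> : chebU (2 * k%:Z - 1) = V k.*2.
  (* For [k = 0] the index is -1, and [chebU] gives [- V 0 = 0]. *)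
  case: k => [|k]; first by rewrite mulr0 sub0r /= oppr0.
  by have -> : (2 * k.+1%:Z - 1 = Posz (k.*2.+1))%R by lia.
by [].
Qed.

Lemma alpha_odd N m : odd N -> N = (m.*2 - 3)%N -> (2 < m)%N -> alpha R N = m.+1%:R^-1.
Proof.
move=> oN NE m2; rewrite /alpha oN; have -> : (N + 5 = 2 * m.+1)%N by lia.
by rewrite natrM invfM mulrA divff ?mul1r// pnatr_eq0.
Qed.

Lemma alpha_even N m : ~~ odd N -> N = (m.*2 - 2)%N -> (2 < m)%N -> alpha R N = m.+1%:R^-1.
Proof.
move=> eN NE m2; rewrite /alpha (negbTE eN); have -> : (N + 4 = 2 * m.+1)%N by lia.
by rewrite natrM invfM mulrA divff ?mul1r// pnatr_eq0.
Qed.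

Lemma coefs_A_tr N m (y : R) : odd N -> N = (m.*2 - 3)%N -> (2 < m)%N ->
  root (V m.+1) y -> y != 0 -> 0 < 1 - y ^+ 2 -> coefs_A N y (tr_poly (A_poly m y)).
Proof.
move=> oN NE m2 yr y0 y1 k kN; have m0 : (0 < m)%N by lia.
have km : (k <= m.-1)%N by lia.
rewrite addn1 addn2 mul2n !coef_tr_polyS ucoef_A_poly_odd ucoef_A_poly_even ?(lt0r_neq0 y1)//.
by rewrite (A_oddE _ _ (alpha_odd oN NE m2)).
Qed.

Lemma family_A_tr N m (y tau : R) : ~~ odd N -> N = (m.*2 - 2)%N -> (2 < m)%N ->
  root (V m.+1) y -> y != 0 -> 0 < 1 - y ^+ 2 ->
  (size (A_poly m y) + 3 = m.*2)%N ->
  family_A N y ((V m).[y] * tau) (tr_poly (A_poly m y * (1 + tau *: 'X))).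
Proof.
move=> eN NE m2 yr y0 y1 sQ0; have m0 : (0 < m)%N by lia.
have y1' := lt0r_neq0 y1.
have [he ho] := ucoefMX_even tau (fun j (h : (j <= m.-1)%N) => ucoef_A_poly_even y0 y1' yr h m0) (ucoef_A_poly_odd m y).
split=> [|k kN].
  by apply: normalized_linear_factor NE sQ0 _; rewrite -[0%N]double0 he// Aseq0.
have km : (k <= m.-1)%N by lia.
have km' : (k < m.-1)%N by lia.
rewrite addn1 addn2 mul2n !coef_tr_polyS he// ho//; split.
  by rewrite (A_oddE _ _ (alpha_even eN NE m2)).
congr (_%:C); rewrite -A_seq_add//; last by lia.
rewrite /A_even -[RHS]mulrA mulrCA; congr (_ * _); congr (_ * _).
have -> : (N + 4 = 2 * m.+1)%N by lia.
have -> : chebU (N./2 - k)%N = V (m - k).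
  by rewrite /=; congr (chebV _ _); lia.
rewrite /= natrM; field; rewrite nat1r pnatr_eq0 //.
Qed.

Lemma family_A_inj N (y tau : R) (P P' : {poly R[i]}) : ~~ odd N ->
  family_A N y tau P -> family_A N y tau P' -> P = P'.
Proof.
move=> eN [nP H] [nP' H']; apply: (normalized_poly_eq eN nP nP') => k kN.
by have [-> ->] := H _ kN; have [-> ->] := H' _ kN.
Qed.

Lemma family_zeta_inj N (y tau : R) (P P' : {poly R[i]}) : ~~ odd N -> (1 < N)%N ->
  family_zeta N y tau P -> family_zeta N y tau P' -> P = P'.
Proof.
move=> eN N1 [nP H] [nP' H']; apply: (normalized_poly_eq eN nP nP') => k kN.
have kN' : (1 <= k.+1 <= N./2)%N by lia.
have e1 : (2 * k + 1 = 2 * k.+1 - 1)%N by lia.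
have e2 : (2 * k + 2 = 2 * k.+1)%N by lia.
by rewrite e1 e2; have [-> ->] := H _ kN'; have [-> ->] := H' _ kN'.
Qed.

(** The alternative [n = 0] covers the empty sums whose shift [d] exceeds [M]. *)
Lemma eq_corr (z z' : nat -> R) M n d : (forall j, (1 <= j <= M)%N -> z j = z' j) ->
  (n + d <= M)%N \/ n = 0%N -> corr z n d = corr z' n d.
Proof.
move=> H [nd|->]; last by rewrite !corr0n.
by apply: eq_big_nat => j /andP[j1 jn]; rewrite !H//; lia.
Qed.

Lemma zetaE N m (y : R) k : N = (m.*2 - 3)%N -> (2 < m)%N -> (1 <= k <= m.-1)%N ->
  zeta N k y = zeta_seq m y k.
Proof.
move=> NE m2 /andP[k1 km]; rewrite /zeta /zeta_seq /=.
have -> : (N + 1)./2 = m.-1 by lia.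
have -> : (N + 3)./2 = m by lia.
have -> : (k - 1).+1 = k by lia.
have -> : (m.-1 - k).+1 = (m - k)%N by lia.
have -> : m.-1.+1 = m by lia.
have -> : (N + 3 = 2 * m)%N by lia.
have m0 : m%:R != 0 :> R by rewrite pnatr_eq0; lia.
have -> : (4 * k)%:R / (2 * m)%:R = 2 * k%:R / m%:R :> R by rewrite !natrM; field.
by [].
Qed.

Lemma zeta_starE N m (y : R) k : N = (m.*2 - 2)%N -> (2 < m)%N -> (1 <= k <= m.-1)%N ->
  zeta_star N k y = zeta_seq m y k.
Proof.
move=> NE m2 /andP[k1 km]; rewrite /zeta_star /zeta_seq /=.
have -> : N./2 = m.-1 by lia.
have -> : (N + 2)./2 = m by lia.
have -> : (k - 1).+1 = k by lia.
have -> : (m.-1 - k).+1 = (m - k)%N by lia.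
have -> : m.-1.+1 = m by lia.
have -> : (N + 2 = 2 * m)%N by lia.
have m0 : m%:R != 0 :> R by rewrite pnatr_eq0; lia.
have -> : (4 * k)%:R / (2 * m)%:R = 2 * k%:R / m%:R :> R by rewrite !natrM; field.
by [].
Qed.

Lemma ucoef_zeta_npoly m (y : R) :
  (forall k, (k <= m.-1)%N ->
    ucoef k.*2 (zeta_npoly m y) = (zeta_autocorr m y k - zeta_autocorr m y k.+1) / (zeta_autocorr m y 0 - zeta_autocorr m y 1)) /\
  (forall k, ucoef k.*2.+1 (zeta_npoly m y) = 0).
Proof.
split=> [k km|k]; rewrite ucoefZ.
  by rewrite mulrC; congr (_ / _); exact: ucoef_zeta_poly_even.
by rewrite ucoef_zeta_poly_odd mulr0.
Qed.

Lemma coefs_zeta_tr N m (y : R) : odd N -> N = (m.*2 - 3)%N -> (2 < m)%N ->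
  coefs_zeta N y (tr_poly (zeta_npoly m y)).
Proof.
move=> oN NE m2 z k /andP[k1 kN]; have m1 : (1 < m)%N by lia.
have [he ho] := ucoef_zeta_npoly m y.
have zE j : (1 <= j <= m.-1)%N -> z j = zeta_seq m y j by exact: zetaE.
have cE n d : (n + d <= m.-1)%N \/ n = 0%N -> corr z n d = corr (zeta_seq m y) n d.
  exact: eq_corr zE.
have e1 : (2 * k - 1 = (k.-1).*2.+1)%N by lia.
have e2 : (2 * k = (k.-1).*2.+2)%N by lia.
rewrite e1 e2 !coef_tr_polyS ho he; last by lia.
split=> //; congr (_%:C); rewrite !cE; [|lia..].
congr ((_ - _) / (_ - _)); rewrite /zeta_autocorr; congr (corr _ _ _); lia.
Qed.

Lemma family_zeta_tr N m (y tau : R) : ~~ odd N -> N = (m.*2 - 2)%N -> (2 < m)%N ->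
  (size (zeta_npoly m y) + 3 = m.*2)%N -> 0 < zeta_autocorr m y 0 - zeta_autocorr m y 1 ->
  family_zeta N y tau (tr_poly (zeta_npoly m y * (1 + tau *: 'X))).
Proof.
move=> eN NE m2 sQ0 n0 z.
have m1 : (1 < m)%N by lia.
have [he0 ho0] := ucoef_zeta_npoly m y.
have [he ho] := ucoefMX_even tau he0 ho0.
split=> [|k /andP[k1 kN]].
  by apply: normalized_linear_factor NE sQ0 _; rewrite -[0%N]double0 he// divff// lt0r_neq0.
have zE j : (1 <= j <= m.-1)%N -> z j = zeta_seq m y j by exact: zeta_starE.
have cE n d : (n + d <= m.-1)%N \/ n = 0%N -> corr z n d = corr (zeta_seq m y) n d.
  exact: eq_corr zE.
have e1 : (2 * k - 1 = (k.-1).*2.+1)%N by lia.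
have e2 : (2 * k = (k.-1).*2.+2)%N by lia.
rewrite e1 e2 !coef_tr_polyS ho ?he; [|lia..].
have -> : corr z ((N + 2)./2 - k) (k - 1) = zeta_autocorr m y k.-1.
  by rewrite cE; [congr (corr _ _ _)|]; lia.
have -> : corr z (N./2 - k) k = zeta_autocorr m y k.
  by rewrite cE; [congr (corr _ _ _)|]; lia.
have -> : corr z N./2 0 = zeta_autocorr m y 0 by rewrite cE; [congr (corr _ _ _)|]; lia.
have -> : corr z (N - 2)./2 1 = zeta_autocorr m y 1 by rewrite cE; [congr (corr _ _ _)|]; lia.
have -> : corr z ((N - 2)./2 - k) (k + 1) = zeta_autocorr m y k.+1.
  by rewrite cE; [congr (corr _ _ _)|]; lia.
rewrite (prednK k1); split=> //; congr (_%:C).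
(* Adjacent differences of autocorrelations telescope, and averaging them gives the factor 1 / 2 of
   [family_zeta]. *)
by rewrite -mulrDl addrA subrK; ring.
Qed.

End Cases.

(** * Assembly of the six cases *)

Theorem theoremA (R : realType) (N : nat) (hN : (3 <= N)%N) :
  (* (a) *)
  (odd N ->
   exists y : R,
     [/\ is_max_root (chebU (N + 3)./2) y,
         y = cos (2 * pi / (N + 5)%:R),
         is_maximum (a3_values R N) (4 * y ^+ 2 - 1)%:C
       & exists P : {poly R[i]},
           unique (max_extremal (T R N)) P /\ coefs_A N y P]) /\
  (* (b) *)
  (~~ odd N ->
   exists y : R,
     [/\ is_max_root (chebU (N + 2)./2) y,
         y = cos (2 * pi / (N + 4)%:R),
         is_maximum (a3_values R N) (4 * y ^+ 2 - 1)%:C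
       & extremal_family (@max_extremal R) N (family_A N y)]) /\
  (* (c) *)
  (odd N -> odd (N + 3)./2 ->
   exists y : R,
     [/\ is_min_pos_root (deriv (chebU (N + 3)./2)) y,
         is_minimum (a3_values R N) (4 * y ^+ 2 - 1)%:C
       & exists P : {poly R[i]},
           unique (min_extremal (T R N)) P /\ coefs_zeta N y P]) /\
  (* (d) *)
  (odd N -> ~~ odd (N + 3)./2 ->
   exists y : R,
     [/\ is_min_pos_root (chebU (N + 3)./2) y,
         y = sin (pi / (N + 5)%:R),
         is_minimum (a3_values R N) (4 * y ^+ 2 - 1)%:C
       & exists P : {poly R[i]},
           unique (min_extremal (T R N)) P /\ coefs_A N y P]) /\
  (* (e) *)
  (~~ odd N -> odd (N + 2)./2 ->
   exists y : R,
     [/\ is_min_pos_root (deriv (chebU (N + 2)./2)) y,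
         is_minimum (a3_values R N) (4 * y ^+ 2 - 1)%:C
       & extremal_family (@min_extremal R) N (family_zeta N y)]) /\
  (* (f) *)
  (~~ odd N -> ~~ odd (N + 2)./2 ->
   exists y : R,
     [/\ is_min_pos_root (chebU (N + 2)./2) y,
         y = sin (pi / (N + 4)%:R),
         is_minimum (a3_values R N) (4 * y ^+ 2 - 1)%:C
       & extremal_family (@min_extremal R) N (family_A N y)]).
Proof.
have max_rE (a b : R) : (a%:C <= b%:C :> R[i]) = (a <= b) by exact: lecR.
have min_rE (a b : R) : (b%:C <= a%:C :> R[i]) = (b <= a) by exact: lecR.
have max_anti (a b : R) : a <= b -> b <= a -> a = b by move=> h1 h2; apply/le_anti/andP.
have min_anti (a b : R) : b <= a -> a <= b -> a = b by move=> h1 h2; apply/le_anti/andP.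
have max_sg (a b : R) : 1 * a <= 1 * b -> a <= b by rewrite !mul1r.
have min_sg (a b : R) : -1 * a <= -1 * b -> b <= a by rewrite !mulN1r lerN2.
have sgN : (-1) ^+ 2 = 1 :> R by rewrite sqrrN expr1n.
have uniq_ext (E : {poly R[i]} -> Prop) P0 : (forall P, E P <-> P = P0) -> unique E P0.
  by move=> H; split=> [|P /H->//]; apply/H.
split=> [oN|].
  (* Since [V] has its index shifted by one, [V m.+1] is [U_((N+3)/2)]. *)
  pose m := (N + 3)./2; have m2 : (2 < m)%N by rewrite /m; lia.
  have NE : N = (m.*2 - 3)%N by rewrite /m; lia.
  have [rt y0 y1 nodes] := max_root_chebV R m2; set y := cos _ in rt y0 y1 nodes.
  have y0' := lt0r_neq0 y0; have [yr _] := rt.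
  have data : extremal_data m 1 y (A_poly m y).
    by apply: extremal_data_A => //; [rewrite expr1n|move=> x xr; rewrite mul1r nodes].
  have [val ext] := odd_case (r := fun a b => a <= b) (rR := fun a b => a <= b) max_rE max_anti max_sg m2 data NE.
  exists y; split=> //.
    rewrite /y; congr cos; have -> : (N + 5 = 2 * m.+1)%N by rewrite {1}NE; lia.
    by rewrite natrM -mulf_div divff ?mul1r.
  exists (tr_poly (A_poly m y)); split; first exact: uniq_ext.
  exact: coefs_A_tr.
split=> [eN|].
  pose m := (N + 2)./2; have m2 : (2 < m)%N by rewrite /m; lia.
  have NE : N = (m.*2 - 2)%N by rewrite /m; lia.
  have [rt y0 y1 nodes] := max_root_chebV R m2; set y := cos _ in rt y0 y1 nodes.
  have y0' := lt0r_neq0 y0; have [yr _] := rt.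
  have data : extremal_data m 1 y (A_poly m y).
    by apply: extremal_data_A => //; [rewrite expr1n|move=> x xr; rewrite mul1r nodes].
  have [_ _ _ sQ0] := data.
  (* The sign [d] is [(V m).[y]], of square 1 because [y] is a zero of [V m.+1]. *)
  have [val ext] := even_case (r := fun a b => a <= b) (rR := fun a b => a <= b) max_rE max_anti max_sg m2 data NE (chebV_before_root_sqr yr)
    (fun tau => family_A_tr tau eN NE m2 yr y0' y1 sQ0)
    (fun tau P P' => @family_A_inj R N y tau P P' eN).
  exists y; split=> //.
  rewrite /y; congr cos; have -> : (N + 4 = 2 * m.+1)%N by rewrite {1}NE; lia.
  by rewrite natrM -mulf_div divff ?mul1r.
split=> [oN om|].
  pose m := (N + 3)./2; have m2 : (2 < m)%N by rewrite /m; lia.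
  have NE : N = (m.*2 - 3)%N by rewrite /m; lia.
  have [y [rt y1 nodes]] := min_pos_root_deriv_chebV R m2 om.
  have [y0 yr _] := rt; have y0' := lt0r_neq0 y0.
  have data := extremal_data_zeta m2 yr y0' y1 nodes.
  have [val ext] := odd_case (r := fun a b => b <= a) (rR := fun a b => b <= a) min_rE min_anti min_sg m2 data NE.
  exists y; split=> //.
  exists (tr_poly (zeta_npoly m y)); split; first exact: uniq_ext.
  exact: coefs_zeta_tr.
split=> [oN em|].
  pose m := (N + 3)./2; have m2 : (2 < m)%N by rewrite /m; lia.
  have NE : N = (m.*2 - 3)%N by rewrite /m; lia.
  have [rt y1 nodes] := min_pos_root_chebV R m2 em; set y := sin _ in rt y1 nodes.
  have [y0 yr _] := rt; have y0' := lt0r_neq0 y0.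
  have data : extremal_data m (-1) y (A_poly m y).
    by apply: extremal_data_A => // x xr; rewrite mulN1r nodes.
  have [val ext] := odd_case (r := fun a b => b <= a) (rR := fun a b => b <= a) min_rE min_anti min_sg m2 data NE.
  exists y; split=> //.
    by rewrite /y; congr (sin (_ / _%:R)); rewrite NE; lia.
  exists (tr_poly (A_poly m y)); split; first exact: uniq_ext.
  exact: coefs_A_tr.
split=> [eN om|eN em].
  pose m := (N + 2)./2; have m2 : (2 < m)%N by rewrite /m; lia.
  have NE : N = (m.*2 - 2)%N by rewrite /m; lia.
  have N1 : (1 < N)%N by lia.
  have [y [rt y1 nodes]] := min_pos_root_deriv_chebV R m2 om.
  have [y0 yr _] := rt; have y0' := lt0r_neq0 y0.
  have data := extremal_data_zeta m2 yr y0' y1 nodes.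
  have [_ _ _ sQ0] := data; have n0 := zeta_autocorr_diff_gt0 (ltnW m2) yr y0' y1.
  have famQ (tau : R) : family_zeta N y (1 * tau) (tr_poly (zeta_npoly m y * (1 + tau *: 'X))).
    by rewrite mul1r; exact: family_zeta_tr.
  have [val ext] := even_case (r := fun a b => b <= a) (rR := fun a b => b <= a) min_rE min_anti min_sg m2 data NE (expr1n _ 2) famQ
    (fun tau P P' => @family_zeta_inj R N y tau P P' eN N1).
  by exists y; split.
pose m := (N + 2)./2; have m2 : (2 < m)%N by rewrite /m; lia.
have NE : N = (m.*2 - 2)%N by rewrite /m; lia.
have [rt y1 nodes] := min_pos_root_chebV R m2 em; set y := sin _ in rt y1 nodes.
have [y0 yr _] := rt; have y0' := lt0r_neq0 y0.
have data : extremal_data m (-1) y (A_poly m y).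
  by apply: extremal_data_A => // x xr; rewrite mulN1r nodes.
have [_ _ _ sQ0] := data.
have [val ext] := even_case (r := fun a b => b <= a) (rR := fun a b => b <= a) min_rE min_anti min_sg m2 data NE (chebV_before_root_sqr yr)
  (fun tau => family_A_tr tau eN NE m2 yr y0' y1 sQ0)
  (fun tau P P' => @family_A_inj R N y tau P P' eN).
exists y; split=> //.
by rewrite /y; congr (sin (_ / _%:R)); rewrite NE; lia.
Qed.
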